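(* Let $R$ be a Henselian local domain with fraction field $K$, suppose that $K$ is perfect, and let $X \subseteq K^n$ be existentially definable. Then there are pairwise disjoint irreducible smooth subvarieties $V_1,\ldots,V_k$ of $\mathbb{A}^n$ and sets $O_1,\ldots,O_k$ such that each $O_i$ is a definable $R$-adically open subset of $V_i(K)$ and $X = O_1 \cup \cdots \cup O_k$.
   Context: All rings are commutative with unit; by convention a local ring is not a field. ''Definable'' means first-order definable in the field $K$ in the language of rings, possibly with parameters from $K$; ''existentially definable'' means definable by an existential formula in the language of rings, possibly with parameters from $K$. A $K$-variety is a separated $K$-scheme of finite type; $V(K)$ is the set of $K$-points of $V$; $\mathbb{A}^n$ is affine $n$-space over $K$, with $\mathbb{A}^n(K) = K^n$. A subvariety of $\mathbb{A}^n$ is understood to be a locally closed subvariety. A local ring $R$ with maximal ideal $\mathfrak{m}$ is Henselian if for any $g \in R[x]$ and $\alpha \in R$ with $g(\alpha) \equiv 0 \pmod{\mathfrak m}$ and $g'(\alpha) \not\equiv 0 \pmod{\mathfrak m}$ there is $\alpha^* \in R$ with $g(\alpha^* ) = 0$ and $\alpha^* \equiv \alpha \pmod{\mathfrak m}$. If $R$ is a local domain with fraction field $K$, then $\{\alpha R + \beta : \alpha \in K^\times, \beta \in K\}$ is a basis for a non-discrete Hausdorff field topology on $K$, called the $R$-adic topology. For a subvariety $V$ of $\mathbb{A}^n$, the $R$-adic topology on $V(K) \subseteq K^n$ is the subspace topology inherited from the product of the $R$-adic topologies on $K^n$. *)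

(* Defs.v *)
From HB Require Import structures.
From mathcomp Require Import all_boot all_order all_algebra.
From mathcomp Require Import mpoly.
From mathcomp Require Import boolp classical_sets.

Set Implicit Arguments.
Unset Strict Implicit.
Unset Printing Implicit Defensive.

Import GRing.Theory.
Local Open Scope classical_set_scope.
Local Open Scope ring_scope.

Section Rings.
Variable R : comNzRingType.
Implicit Types (A I m q : set R).

(* [idealr_closed] includes properness. *)
Definition prime_ideal q : Prop :=
  idealr_closed (mem q) /\ prime_idealr_closed (mem q).

Definition maximal_ideal m : Prop :=
  idealr_closed (mem m) /\
  forall I, idealr_closed (mem I) -> m `<=` I -> I = m.

Definition ideal_span A : set R :=
  [set f | exists (l : nat) (c a : 'I_l -> R),
     (forall i, A (a i)) /\ f = \sum_(i < l) c i * a i].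

Definition Spec : set (set R) := [set q | prime_ideal q].

Definition zero_locus A : set (set R) := [set q | Spec q /\ A `<=` q].

End Rings.

(* A local ring is by convention not a field, hence the last clause. *)
Definition local_ring (R : comUnitRingType) (m : set R) : Prop :=
  [/\ maximal_ideal m,
      forall m' : set R, maximal_ideal m' -> m' = m
    & exists2 x : R, x != 0 & x \isn't a GRing.unit].

Definition henselian (R : comNzRingType) (m : set R) : Prop :=
  forall (g : {poly R}) (a : R), m g.[a] -> ~ m g^`().[a] ->
    exists2 a' : R, root g a' & m (a' - a).

Definition is_fraction_field (R : idomainType) (K : fieldType)
    (iota : {rmorphism R -> K}) : Prop :=
  injective iota /\
  forall x : K, exists a b : R, b != 0 /\ x = iota a / iota b.

Definition perfect_field (K : fieldType) : Prop :=
  forall p : nat, p \in [pchar K] -> forall x : K, exists y : K, y ^+ p = x.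

Section Definability.
Variables (K : fieldType) (n : nat).
Implicit Type X : set (n.-tuple K).

(* The parameters are the constants [c%:T]; [rformula] excludes the inverse and
   the unit predicate, which are not in the language of rings. The variables
   'X_0, ..., 'X_(n-1) stand for the coordinates; a free variable of larger
   index is read as the constant 0. *)
Definition definable X : Prop :=
  exists f : GRing.formula K,
    GRing.rformula f /\ X = [set a | GRing.holds a f].

Definition existentially_definable X : Prop :=
  exists (s : seq nat) (f : GRing.formula K),
    [/\ GRing.qf_form f, GRing.rformula f
      & X = [set a | GRing.holds a (foldr GRing.Exists f s)]].

End Definability.

(* The locally closed subscheme Z(eqns) \ Z(ineqns) of affine n-space. Every
   locally closed subscheme has this form: the coordinate ring is Noetherian,
   so finitely many equations suffice, and a closed subscheme of an open U is
   the intersection of U with its scheme-theoretic closure. *)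
Record subvariety (K : fieldType) (n : nat) := Subvariety {
  eqns : seq {mpoly K[n]};
  ineqns : seq {mpoly K[n]} }.

Section Subvarieties.
Variables (K : fieldType) (n : nat).
Implicit Type V : subvariety K n.

(* The points of the underlying topological space: prime ideals of the
   polynomial ring, with the Zariski topology. *)
Definition points V : set (set {mpoly K[n]}) :=
  zero_locus [set` eqns V] `\` zero_locus [set` ineqns V].

Definition rational_points V : set (n.-tuple K) :=
  [set a | (forall f, f \in eqns V -> f.@[tnth a] = 0) /\
           exists2 g, g \in ineqns V & g.@[tnth a] != 0].

Definition irreducible_subvariety V : Prop :=
  points V !=set0 /\
  forall A B : set {mpoly K[n]},
    points V `<=` zero_locus A `|` zero_locus B ->
    points V `<=` zero_locus A \/ points V `<=` zero_locus B.

(* Smoothness at the point q, in the Jacobian form: the localization at q of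
   the ideal (eqns V) is generated by some g_1, ..., g_c whose differentials are
   linearly independent over the residue field of q, i.e. some c x c minor of
   their Jacobian matrix is not in q. *)
Definition smooth_at V (q : set {mpoly K[n]}) : Prop :=
  exists (c : nat) (g : 'I_c -> {mpoly K[n]}) (h : 'I_c -> 'I_n),
    [/\ forall i, ideal_span [set` eqns V] (g i),
        forall f, ideal_span [set` eqns V] f ->
          exists2 s, ~ q s & ideal_span (range g) (s * f)
      & ~ q (\det (\matrix_(i < c, j < c) mderiv (h j) (g i)))].

Definition smooth V : Prop := forall q, points V q -> smooth_at V q.

End Subvarieties.

Section RadicTopology.
Variables (R : idomainType) (K : fieldType) (iota : {rmorphism R -> K}).

Definition radic_basic (alpha beta : K) : set K :=
  [set x | exists r : R, x = alpha * iota r + beta].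

(* The product topology on K^n, with basis the boxes of basic open sets. *)
Definition radic_open (n : nat) (U : set (n.-tuple K)) : Prop :=
  forall a, U a -> exists alpha beta : 'I_n -> K,
    [/\ forall i, alpha i != 0,
        forall i, radic_basic (alpha i) (beta i) (tnth a i)
      & [set b : n.-tuple K |
           forall i, radic_basic (alpha i) (beta i) (tnth b i)] `<=` U].

Definition radic_open_in (n : nat) (S O : set (n.-tuple K)) : Prop :=
  exists2 U, radic_open U & O = S `&` U.

End RadicTopology.

(* Main.v *)
(* The sets [X] for which every irreducible closed subset of affine space has a
   nonempty open subset [V] with [X] relatively open in [V(K)] contain the
   quantifier-free sets, and are closed under projection along one coordinate:
   above the generic point of the base, either the last coordinate is
   transcendental and openness is immediate, or it is a root of an irreducible
   polynomial [pi] over the function field. Writing [pi(t) = rho(t^Q)] with [rho]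
   separable and [Q] a power of the characteristic exponent, a root of [rho]
   moves continuously by Hensel's lemma, and [t] is recovered as a [Q]-th root
   because [K] is perfect. As the Frobenius need not be open for the [R]-adic
   topology, openness is required simultaneously for all embeddings of [R] in [K]
   with fraction field [K], among them the Frobenius twists of [iota]; the twist by
   [Q] absorbs the [Q]-th root. The decomposition then follows by Noetherian
   induction, irreducible varieties over a perfect field being generically smooth:
   if a Jacobian minor of maximal size does not vanish at the generic point, the
   remaining coordinates form a separating transcendence basis. *)
Require Import Defs.
From HB Require Import structures.
From mathcomp Require Import all_boot all_order all_algebra.
From mathcomp Require Import ring.
From mathcomp Require Import mpoly generic_quotient.
From mathcomp Require Import boolp classical_sets.

Set Implicit Arguments.
Unset Strict Implicit.
Unset Printing Implicit Defensive.

Import GRing.Theory.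
Local Open Scope classical_set_scope.
Local Open Scope ring_scope.

(** * The R-adic topology and the implicit function theorem *)

(** For a given prime [q], a projection involves only finitely many primes above it. The generic
    point of the line over the residue field [L] yields a polynomial [st], and where [st] vanishes
    only the irreducible factors of its image over [L] remain. Each of them excludes a hypersurface
    of its own. Bezout identities and divisions over [L], once denominators are cleared, hold modulo
    [q] and so specialize to rational points.

    [R] need not be a valuation ring, so valuations cannot be compared to prepare Hensel's lemma.
    Instead the equation is rescaled until its coefficients lie in [R], its linear coefficient is 1
    and its constant term lies in [m].

    Smoothness asks for more than a nonzero minor: the chosen equations must generate the ideal
    locally. They are found by eliminating one variable at a time, with derivations into the residue
    field controlling separability. *)

Section SmallElements.
Variables (R : idomainType) (K : fieldType) (iota : {rmorphism R -> K}).

(** Membership in the fractional ideal [lam R]. For [lam != 0] these ideals are the basic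
    neighbourhoods of 0, and a single radius replaces the independent radii of a box. *)
Definition small (lam x : K) : Prop := exists r : R, x = lam * iota r.

Definition near N (lam : K) (b b' : 'I_N -> K) : Prop :=
  forall i, small lam (b' i - b i).

Lemma small0 lam : small lam 0.
Proof. by exists 0; rewrite rmorph0 mulr0. Qed.

Lemma smallxx lam : small lam lam.
Proof. by exists 1; rewrite rmorph1 mulr1. Qed.

Lemma smallD lam x y : small lam x -> small lam y -> small lam (x + y).
Proof. by move=> [r ->] [s ->]; exists (r + s); rewrite rmorphD mulrDr. Qed.

Lemma small_trans lam mu x : small mu lam -> small lam x -> small mu x.
Proof. by move=> [r ->] [s ->]; exists (r * s); rewrite rmorphM mulrA. Qed.

Lemma smallM lam mu x y : small lam x -> small mu y -> small (lam * mu) (x * y).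
Proof. by move=> [r ->] [s ->]; exists (r * s); rewrite rmorphM mulrACA. Qed.

Lemma small1X x k : small 1 x -> small 1 (x ^+ k).
Proof.
move=> sx; elim: k => [|k IH]; first by rewrite expr0; apply: smallxx.
by rewrite exprS -[1]mulr1; apply: smallM.
Qed.

Hypothesis fracK : is_fraction_field iota.

Lemma iota_inj : injective iota. Proof. by case: fracK. Qed.

Lemma frac_neq0 (x : K) : x != 0 ->
  exists a b : R, [/\ a != 0, b != 0 & x = iota a / iota b].
Proof.
case: fracK => inj fr x0; have [a [b [b0 xE]]] := fr x.
exists a, b; split=> //; apply: contraNneq x0 => a0.
by rewrite xE a0 rmorph0 mul0r.
Qed.

Lemma iota_eq0 a : (iota a == 0) = (a == 0).
Proof. by rewrite -(inj_eq iota_inj) rmorph0. Qed.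

(** The product of the two numerators lies in both fractional ideals. *)
Lemma small_cap lam mu : lam != 0 -> mu != 0 ->
  exists2 nu, nu != 0 & small lam nu /\ small mu nu.
Proof.
move=> /frac_neq0 [a [b [a0 b0 ->]]] /frac_neq0 [c [d [c0 d0 ->]]].
exists (iota (a * c)); first by rewrite iota_eq0 mulf_neq0.
split; [exists (b * c)|exists (d * a)].
  by rewrite !rmorphM mulrA divfK ?iota_eq0.
by rewrite !rmorphM mulrA divfK ?iota_eq0 // mulrC.
Qed.

Lemma small_absorb (c mu : K) : mu != 0 ->
  exists2 nu, nu != 0 & forall x, small nu x -> small mu (x * c).
Proof.
move=> mu0; have [->|c0] := eqVneq c 0.
  by exists mu => // x _; rewrite mulr0; apply: small0.
exists (mu / c); first by rewrite mulf_neq0 // invr_eq0.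
by move=> _ [r ->]; exists r; rewrite mulrAC divfK.
Qed.

Lemma near_trans N lam mu (b b' : 'I_N -> K) :
  small mu lam -> near lam b b' -> near mu b b'.
Proof. by move=> ml nb i; apply: small_trans (nb i). Qed.

Lemma near_cap N lam mu : lam != 0 -> mu != 0 ->
  exists2 nu, nu != 0 &
    forall b b' : 'I_N -> K, near nu b b' -> near lam b b' /\ near mu b b'.
Proof.
move=> l0 m0; have [nu nu0 [ln mn]] := small_cap l0 m0.
by exists nu => // b b' nb; split; apply: near_trans nb.
Qed.

(** The polynomials continuous at [b] include constants and variables and are closed under sums and
    products. *)
Lemma meval_continuous N (p : {mpoly K[N]}) (b : 'I_N -> K) mu : mu != 0 ->
  exists2 lam, lam != 0 &
    forall b', near lam b b' -> small mu (p.@[b'] - p.@[b]).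
Proof.
pose C (q : {mpoly K[N]}) := forall mu, mu != 0 -> exists2 lam, lam != 0 &
    forall b', near lam b b' -> small mu (q.@[b'] - q.@[b]).
have CC c : C c%:MP.
  by move=> nu nu0; exists 1 => [|b' _]; rewrite ?oner_eq0 // !mevalC subrr; apply: small0.
have CX i : C 'X_i by move=> nu nu0; exists nu => // b' nb; rewrite !mevalXU.
have CD q r : C q -> C r -> C (q + r).
  move=> Cq Cr nu nu0; have [l1 l10 H1] := Cq _ nu0; have [l2 l20 H2] := Cr _ nu0.
  have [l l0 H] := near_cap N l10 l20; exists l => // b' /H[n1 n2].
  by rewrite !mevalD opprD addrACA; apply: smallD; [apply: H1|apply: H2].
have CM q r : C q -> C r -> C (q * r).
  move=> Cq Cr nu nu0.
  have [nuq nuq0 Hq] := small_absorb r.@[b] nu0.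
  have [nur nur0 Hr] := small_absorb q.@[b] nu0.
  have [l1 l10 H1] := Cq _ nu0; have [l2 l20 H2] := Cr _ (oner_neq0 K).
  have [l3 l30 H3] := Cq _ nuq0; have [l4 l40 H4] := Cr _ nur0.
  have [l5 l50 H5] := near_cap N l10 l20; have [l6 l60 H6] := near_cap N l30 l40.
  have [l l0 H] := near_cap N l50 l60; exists l => // b' /H[/H5[n1 n2] /H6[n3 n4]].
  rewrite !mevalM; have -> : q.@[b'] * r.@[b'] - q.@[b] * r.@[b] =
    (q.@[b'] - q.@[b]) * (r.@[b'] - r.@[b]) + ((q.@[b'] - q.@[b]) * r.@[b]
     + (r.@[b'] - r.@[b]) * q.@[b]) by ring.
  apply: smallD; last by apply: smallD; [apply/Hq/H3|apply/Hr/H4].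
  by rewrite -[nu]mulr1; apply: smallM; [apply: H1|apply: H2].
move: mu; rewrite -/(C p); elim/mpolyind: p => [|c m p _ _ Cp].
  by rewrite -mpolyC0; apply/CC.
apply/CD => //; rewrite -mul_mpolyC; apply/CM => //.
rewrite mpolyXE_id; elim/big_ind: _ => [|q r|i _]; [|exact: CM|].
  by rewrite -mpolyC1; apply: CC.
elim: (m i) => [|k IH]; first by rewrite expr0 -mpolyC1; apply: CC.
by rewrite exprS; apply/CM.
Qed.

Lemma near_all N (b : 'I_N -> K) (n : nat) (Pr : nat -> ('I_N -> K) -> Prop) :
  (forall k, exists2 lam, lam != 0 & forall b', near lam b b' -> Pr k b') ->
  exists2 lam, lam != 0 &
    forall b', near lam b b' -> forall k, (k < n)%N -> Pr k b'.
Proof.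
move=> H; elim: n => [|n [l1 l10 H1]]; first by exists 1; rewrite ?oner_neq0.
have [l2 l20 H2] := H n; have [l l0 Hl] := near_cap N l10 l20.
exists l => // b' /Hl[/H1 n1 /H2 n2] k.
by rewrite ltnS leq_eqVlt => /predU1P[->|/n1].
Qed.

(** Clears finitely many denominators at once; it provides the scale of the root in the implicit
    function theorem. *)
Lemma small_absorb_all (n : nat) (c : nat -> K) (mu : K) : mu != 0 ->
  exists2 nu, nu != 0 & small mu nu /\ forall k, (k < n)%N -> small 1 (nu * c k).
Proof.
move=> mu0; elim: n => [|n [l1 l10 [H0 H1]]]; first by exists mu => //; split=> //; apply: smallxx.
have [l2 l20 H2] := small_absorb (c n) (oner_neq0 K).
have [l l0 [s1 s2]] := small_cap l10 l20.
exists l => //; split; first by apply: small_trans s1.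
move=> k; rewrite ltnS leq_eqVlt => /predU1P[->|kn]; first exact: H2.
have [r ->] := s1; rewrite mulrAC; have [t ->] := H1 _ kn.
by exists (t * r); rewrite rmorphM mulrA.
Qed.

Lemma poly_lift (q : {poly K}) :
  (forall k, exists r, q`_k = iota r) -> exists g : {poly R}, map_poly iota g = q.
Proof.
move=> /choice [r rE]; exists (\poly_(k < size q) r k).
apply/polyP=> k; rewrite coef_map coef_poly /=.
by case: ltnP => kq; [rewrite rE | rewrite rmorph0 nth_default].
Qed.

Variables (m : set R) (localR : local_ring m) (henselR : henselian m).

Lemma max_ideal_closed : idealr_closed (mem m).
Proof. by case: localR => -[]. Qed.

Lemma max_ideal1 : ~ m 1.
Proof. by case: max_ideal_closed => _ /negP + _ => + ?; apply; rewrite inE. Qed.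

Lemma max_ideal0 : m 0.
Proof. by case: max_ideal_closed; rewrite inE. Qed.

Lemma max_idealMl a u : m u -> m (a * u).
Proof.
move=> mu; case: max_ideal_closed => _ _ /(_ a u 0); rewrite !inE addr0.
by apply=> //; apply: max_ideal0.
Qed.

Lemma max_idealD u v : m u -> m v -> m (u + v).
Proof.
move=> mu mv; case: max_ideal_closed => _ _ /(_ 1 u v); rewrite !inE mul1r.
exact.
Qed.

(** Hensel's lemma for the linear polynomial [(1 + u) X - 1] at 1, where its value is [u] and its
    derivative [1 + u] is outside [m]. *)
Lemma unit_1D u : m u -> exists e, (1 + u) * e = 1.
Proof.
move=> mu; have [||e re _] := henselR (g := (1 + u) *: 'X - 1%:P) (a := 1).
- by rewrite !hornerE addrC addKr.
- rewrite !derivE !hornerE /= subr0 => m1u; apply: max_ideal1.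
  by rewrite -[1](addrK u) -mulN1r; apply: max_idealD => //; apply: max_idealMl.
exists e; apply/eqP; move: re.
by rewrite rootE !hornerE subr_eq0.
Qed.

(** If [m] were 0, the ideal generated by a nonzero nonunit would contain [m] and, being proper,
    equal it. A nonzero element of [m] later turns estimates in [R] into estimates in [m]. *)
Lemma max_ideal_neq0 : exists2 x, m x & x != 0.
Proof.
apply: contrapT => H; have m0 x : m x -> x = 0.
  by move=> mx; apply/eqP; apply: contrapT => /negP x0; apply: H; exists x.
case: localR => -[_ maxm] _ [x x0 xnu].
pose I : set R := [set y | exists r, y = r * x].
have Iid : idealr_closed (mem I).
  split; rewrite ?inE; first by exists 0; rewrite mul0r.
    apply/negP; rewrite inE => -[r r1]; move/negP: xnu; apply.
    by apply/unitrP; exists r; split; [|rewrite mulrC]; rewrite -r1.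
  move=> a u v; rewrite !inE => -[r ->] [s ->].
  by exists (a * r + s); rewrite mulrDl mulrA.
have Im : I = m by apply: maxm => // y /m0->; exists 0; rewrite mul0r.
by move/eqP: x0; apply; apply: m0; rewrite -Im; exists 1; rewrite mul1r.
Qed.

(** With [z = gam w], dividing by [gam] times the linear coefficient at [b'] produces a polynomial
    over [R] with linear coefficient 1 and constant term in [m]. Hensel's lemma at 0 gives [w], and
    [gam w] is small because [gam] lies in [mu R]. *)
Lemma implicit_function0 N (P : {poly {mpoly K[N]}}) (b : 'I_N -> K) mu :
  (P`_0).@[b] = 0 -> (P`_1).@[b] != 0 -> mu != 0 ->
  exists2 lam, lam != 0 & forall b', near lam b b' ->
    exists2 z, small mu z & root (map_poly (meval b') P) z.
Proof.
move=> P0 u0 mu0; set u := (P`_1).@[b] in u0.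
have [p mp p0] := max_ideal_neq0.
(* The elements [gam / u], [gam] and [gam P_j(b) / u] all lie in [R]; this makes the rescaled
   coefficients of degree at least 2 integral. *)
have [gam gam0 [mugam gamc]] := small_absorb_all
  (size P).+2 (fun k => match k with 0 => u^-1 | 1 => 1
     | j.+2 => (P`_j).@[b] / u end) mu0.
have gam1 : small 1 (gam * u^-1) by apply: (gamc 0%N).
(* When the coefficients move by multiples of [nu], the constant one lies in [gam u p R] and the
   linear one is [u] times a unit of [R]. *)
have [nu nu0 [nu1 [nu2 [nu3 nu4]]]] : exists2 nu, nu != 0 &
    small 1 nu /\ small (gam * u * iota p) nu /\ small (u * iota p) nu /\
    small 1 nu.
  have n1 : gam * u * iota p != 0 by rewrite !mulf_neq0 ?iota_eq0.
  have n2 : u * iota p != 0 by rewrite !mulf_neq0 ?iota_eq0.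
  have [x x0 [s1 s2]] := small_cap n1 n2.
  have [y y0 [s3 s4]] := small_cap x0 (oner_neq0 K).
  exists y => //; split=> //; split; first exact: small_trans s3.
  by split=> //; apply: small_trans s3.
have [lam lam0 H] := @near_all _ b (size P).+2 (fun k b' =>
   small nu ((P`_k).@[b'] - (P`_k).@[b])) (fun k => meval_continuous _ _ nu0).
exists lam => // b' /H{}H.
pose f k := (P`_k).@[b'].
have [r0 f0E] : small (gam * u * iota p) (f 0).
  by apply: small_trans nu2 _; rewrite -[f 0%N]subr0 -P0; apply: H.
have [r1 f1E] : small (u * iota p) (f 1 - u).
  by apply: small_trans nu3 _; apply: H.
have [e eE] : exists e, (1 + p * r1) * e = 1.
  by apply: unit_1D; rewrite mulrC; apply: max_idealMl.
have f1u : f 1 = u * iota (1 + p * r1).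
  by rewrite -[f 1%N](subrK u) f1E rmorphD rmorphM rmorph1 mulrDr mulr1 mulrA addrC.
have f1V : f 1 / u * iota e = 1.
  by rewrite f1u [u * _]mulrC mulfK // -rmorphM eE rmorph1.
have f10 : f 1 != 0.
  by apply: contra_eq_neq f1V => ->; rewrite !mul0r eq_sym oner_neq0.
have f1VE : (f 1)^-1 = u^-1 * iota e.
  by apply: (mulfI f10); rewrite mulfV // mulrA.
have f0lift : (gam * f 1)^-1 * f 0 = iota (p * r0 * e).
  rewrite f0E invfM f1VE !rmorphM; field; by rewrite gam0 u0.
pose P' := map_poly (meval b') P.
have P'E k : P'`_k = f k by rewrite coef_map.
pose q := \poly_(k < size P') (f k * gam ^+ k / (gam * f 1)).
have sP' : (size P' <= size P)%N by apply: size_poly.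
have qE k : q`_k = f k * gam ^+ k / (gam * f 1).
  rewrite coef_poly; case: ltnP => // kP.
  by rewrite -P'E nth_default // !mul0r.
have [g gE] : exists g : {poly R}, map_poly iota g = q.
  apply: poly_lift => -[|[|k]].
  - by exists (p * r0 * e); rewrite qE expr0 mulr1 mulrC f0lift.
  - by exists 1; rewrite qE expr1 rmorph1 [f 1%N * _]mulrC mulfV // mulf_neq0.
  case: (ltnP k.+2 (size P)) => [kP|Pk]; last first.
    by exists 0; rewrite qE -P'E nth_default ?(leq_trans sP') // !mul0r rmorph0.
  suff [r rE] : small 1 (q`_k.+2) by exists r; rewrite rE mul1r.
  have -> : q`_k.+2 = gam ^+ k * ((gam / u) * f k.+2) * iota e.
    rewrite qE invfM f1VE exprSr exprSr; field; by rewrite gam0 u0.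
  rewrite -[1]mulr1; apply: smallM; last by exists e; rewrite mul1r.
  rewrite -[1]mulr1; apply: smallM.
    by apply: small1X; rewrite -[gam]mulr1; apply: (gamc 1%N).
  have -> : gam / u * f k.+2 =
      gam * ((P`_k.+2).@[b] / u) + gam / u * (f k.+2 - (P`_k.+2).@[b]) by field.
  apply: smallD; first by apply: (gamc k.+4).
  rewrite -[1]mulr1; apply: smallM => //.
  by apply: small_trans nu1 _; apply: H; rewrite ltnW // ltnW.
have g0 : g`_0 = p * r0 * e.
  by apply: iota_inj; rewrite -f0lift -coef_map gE qE expr0 mulr1 mulrC.
have g1 : g`_1 = 1.
  apply: iota_inj; rewrite -coef_map gE qE expr1 rmorph1 [f 1%N * _]mulrC.
  by rewrite mulfV // mulf_neq0.
have [||w rw _] := henselR (g := g) (a := 0).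
- by rewrite horner_coef0 g0 mulrC; apply: max_idealMl; rewrite mulrC; apply: max_idealMl.
- by rewrite horner_coef0 coef_deriv g1; apply: max_ideal1.
exists (gam * iota w); first by apply: small_trans mugam _; exists w.
have := rmorph_root iota rw; rewrite gE !rootE horner_poly -/P' => /eqP q0.
have : (gam * f 1)^-1 * P'.[gam * iota w] = 0.
  rewrite -[RHS]q0 horner_coef mulr_sumr; apply: eq_bigr => k _.
  by rewrite P'E exprMn; ring.
by move/eqP; rewrite mulf_eq0 invr_eq0 mulf_eq0 (negPf gam0) (negPf f10).
Qed.

(** Translation by [z] reduces to a simple root at 0: the value and the derivative at [z] are the
    first two coefficients of the shifted polynomial. *)
Lemma implicit_function N (P : {poly {mpoly K[N]}}) (b : 'I_N -> K) (z mu : K) :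
  root (map_poly (meval b) P) z -> ~~ root (map_poly (meval b) P^`()) z ->
  mu != 0 ->
  exists2 lam, lam != 0 & forall b', near lam b b' ->
    exists2 z', small mu (z' - z) & root (map_poly (meval b') P) z'.
Proof.
move=> rz nrz mu0; pose P1 := P \Po ('X + (z%:MP)%:P).
have P1E b' : map_poly (meval b') P1 = map_poly (meval b') P \Po ('X + z%:P).
  by rewrite map_comp_poly rmorphD /= map_polyX map_polyC /= mevalC.
have [||lam lam0 H] := @implicit_function0 _ P1 b mu _ _ mu0.
- have := coef_map (meval b) P1 0; rewrite /= => <-.
  by rewrite P1E -horner_coef0 horner_comp !hornerE; apply/eqP.
- have := coef_map (meval b) P1 1; rewrite /= => <-.
  have -> (r : {poly K}) : r`_1 = r^`().[0] by rewrite horner_coef0 coef_deriv.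
  by rewrite P1E deriv_comp !derivE !hornerE horner_comp !hornerE deriv_map.
exists lam => // b' /H[w sw rw]; exists (w + z); first by rewrite addrK.
by move: rw; rewrite P1E !rootE horner_comp !hornerE.
Qed.

End SmallElements.

(** * Residue fields of primes, separable polynomials, Frobenius twists *)

Section ClassicalDomain.
Variables (A : comNzRingType) (domA : forall x y : A, x * y = 0 -> (x == 0) || (y == 0)).

(** An [idomainType] carries a unit test and an inverse, supplied here by classical choice. The
    [let] makes the alias depend on [domA], so that the instances below can use it. *)
Definition classical_domain : Type := let _ := domA in A.
HB.instance Definition _ := GRing.ComNzRing.on classical_domain.

Let unit_dom : {pred classical_domain} := fun x => `[< exists y, y * x = 1 >].
Let inv_dom (x : classical_domain) : classical_domain :=
  if pselect (exists y, y * x = 1) is left ex then sval (cid ex) else x.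

Fact mulV_dom : {in unit_dom, left_inverse 1 inv_dom *%R}.
Proof.
move=> x; rewrite unfold_in => /asboolP ex; rewrite /inv_dom.
by case: pselect => // ex'; case: cid.
Qed.

Fact unitP_dom x y : y * x = 1 -> unit_dom x.
Proof. by move=> xy; apply/asboolP; exists y. Qed.

Fact inv_out_dom : {in [predC unit_dom], inv_dom =1 id}.
Proof.
move=> x; rewrite inE unfold_in => /asboolPn nex; rewrite /inv_dom.
by case: pselect.
Qed.

HB.instance Definition _ := GRing.ComNzRing_hasMulInverse.Build classical_domain
  mulV_dom unitP_dom inv_out_dom.
HB.instance Definition _ := GRing.ComUnitRing_isIntegral.Build classical_domain domA.

End ClassicalDomain.

Section ResidueField.
Variables (A : comNzRingType) (q : set A) (prime_q : prime_ideal q).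

Let mem_q : A -> bool := let _ := prime_q in fun x => x \in q.
HB.instance Definition _ := isIdealr.Build A mem_q prime_q.1.
HB.instance Definition _ := isPrimeIdealrClosed.Build A mem_q prime_q.2.

Let D := classical_domain (@Quotient.rquot_IdomainAxiom A mem_q).

Local Open Scope quotient_scope.

Lemma fraction_numden (B : idomainType) (x : {fraction B}) :
  exists u v : B, v != 0 /\ x = FracField.tofrac u / FracField.tofrac v.
Proof.
elim/quotW: x => y; exists (\n_y), (\d_y); split; first exact: denom_ratioP.
rewrite -[y in LHS]Ratio_numden /GRing.inv /GRing.mul /=.
rewrite !piE /FracField.mulf /FracField.invf.
by rewrite !numden_Ratio ?oner_neq0 ?denom_ratioP // mulr1 mul1r.
Qed.

(** The fraction field of the quotient by [q]. That every element is a quotient of two values of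
    [phi] is what allows denominators to be cleared later. *)
Lemma residue_field : exists (L : fieldType) (phi : {rmorphism A -> L}),
  (forall f, phi f = 0 <-> q f) /\
  (forall x, exists u v, phi v != 0 /\ x = phi u / phi v).
Proof.
pose I : prime_idealr A := mem_q.
pose Q := Quotient.quot I.
pose p : {rmorphism A -> Q} := \pi_Q.
pose phi : {rmorphism A -> {fraction D}} := @FracField.tofrac D \o (p : {rmorphism A -> D}).
have phi0 f : phi f = 0 <-> q f.
  rewrite /phi /= (rwP eqP) tofrac_eq0.
  have E := Quotient.idealrBE I f 0; rewrite subr0 in E.
  have -> : (p f == 0) = (f \in q) by rewrite -[f \in q]/(f \in I) E -[0 in LHS](rmorph0 p).
  by rewrite inE.
exists {fraction D}, phi; split=> // x.
have [u [v [v0 ->]]] := fraction_numden x.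
exists (repr (u : Q)), (repr (v : Q)).
by rewrite /phi /= !reprK tofrac_eq0.
Qed.
End ResidueField.

Lemma irreducible_divisor (F : fieldType) (h : {poly F}) : (1 < size h)%N ->
  exists2 p, irreducible_poly p & p %| h.
Proof.
have [n] := ubnP (size h); elim: n h => // n IH h; rewrite ltnS => hn h1.
have [irr|nirr] := pselect (irreducible_poly h); first by exists h.
have [q [q1 qh nqh]] : exists q : {poly F}, [/\ size q != 1, q %| h & ~ q %= h].
  apply: contrapT => H; apply: nirr; split=> // q q1 qh.
  by apply: contrapT => nqh; apply: H; exists q.
have h0 : h != 0 by rewrite -size_poly_gt0 ltnW.
have q0 : q != 0 by apply: contraNneq h0 => q0; rewrite q0 dvd0p in qh.
have sq : (size q < size h)%N.
  rewrite ltn_neqAle dvdp_leq // andbT; apply/negP => /eqP sqh; apply: nqh.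
  by rewrite -dvdp_size_eqp // sqh.
have [||p irrp pq] := IH q; first exact: leq_trans hn.
  by rewrite ltn_neqAle eq_sym q1 size_poly_gt0.
by exists p => //; apply: dvdp_trans qh.
Qed.

(** A zero derivative means that [k] times the coefficient of degree [k] is always 0. The leading
    coefficient shows that the characteristic is positive, and then only exponents divisible by it
    occur. *)
Lemma deriv_eq0_comp (F : fieldType) (h : {poly F}) :
  h^`() = 0 -> (1 < size h)%N ->
  exists2 p, p \in [pchar F] & exists g, h = g \Po 'X^p.
Proof.
move=> dh h1.
have coefh k : h`_k *+ k = 0.
  case: k => [|k]; first by rewrite mulr0n.
  by rewrite -coef_deriv dh coef0.
have h0 : h != 0 by rewrite -size_poly_gt0 ltnW.
have [||p pF] := @natf0_pchar F (size h).-1.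
- by rewrite -ltnS prednK // ltnW.
- have /eqP := coefh (size h).-1; rewrite -[_ *+ _]mulr_natr mulf_eq0.
  by rewrite -lead_coefE lead_coef_eq0 (negPf h0).
exists p => //; exists (\poly_(k < size h) h`_(k * p)).
have p0 : (0 < p)%N by rewrite prime_gt0 // (pcharf_prime pF).
apply/polyP => k; rewrite coef_comp_poly_Xn // coef_poly.
have /eqP := coefh k; rewrite -[_ *+ _]mulr_natr mulf_eq0 -(dvdn_pcharf pF).
case: ifP => [pk _|_]; last by rewrite orbF => /eqP.
rewrite divnK //; case: ltnP => // hk; rewrite nth_default //.
by apply: leq_trans hk _; apply: leq_div.
Qed.

(** A divisor of [g] composed with [X^n] divides [g(X^n)], and composition multiplies all degrees by
    [n]. *)
Lemma irreducible_comp_Xn (F : fieldType) (g : {poly F}) n : (0 < n)%N ->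
  irreducible_poly (g \Po 'X^n) -> irreducible_poly g.
Proof.
move=> n0 irr; have sX (q : {poly F}) : (size (q \Po 'X^n)).-1 = ((size q).-1 * n)%N.
  by rewrite size_comp_poly size_polyXn.
have g0 : g != 0.
  by apply: contraTneq (irredp_neq0 irr) => ->; rewrite comp_poly0 eqxx.
have sg : (0 < (size g).-1)%N.
  by have := sX g; case: irr; case: (size (g \Po _)) => [|[|k]] // _ _ /=; case: (_.-1).
split=> [|q q1 /dvdpP[u gE]]; first by rewrite -ltn_predRL.
have q0 : q != 0 by apply: contraNneq g0 => q0; rewrite gE q0 mulr0.
have sq : (0 < (size q).-1)%N.
  by rewrite -size_poly_gt0 in q0; case: (size q) q0 q1 => [|[|]].
have : q \Po 'X^n %= g \Po 'X^n.
  apply: apply_irredp => //; last by rewrite gE comp_polyM dvdp_mull.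
  by apply/eqP => s1; have := sX q; rewrite s1 /= => /esym/eqP; rewrite muln_eq0 !eqn0Ngt sq n0.
move/eqp_size/(congr1 predn); rewrite !sX => /eqP; rewrite eqn_pmul2r // => /eqP sqg.
rewrite -dvdp_size_eqp; last by rewrite gE dvdp_mull.
by rewrite -(prednK (leq_trans sq (leq_pred _))) sqg prednK // (leq_trans sg (leq_pred _)).
Qed.

(** [X^p] is peeled off as long as the derivative vanishes; an irreducible polynomial with nonzero
    derivative is coprime to it. The condition on [n] forces [n = 1] in characteristic 0. *)
Lemma irreducible_separable_Xn (F : fieldType) (h : {poly F}) :
  irreducible_poly h -> exists g n,
    [/\ h = g \Po 'X^n, [pchar F].-nat n & coprimep g g^`()].
Proof.
have [k] := ubnP (size h); elim: k h => // k IH h; rewrite ltnS => hk irr.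
have [dh|dh] := eqVneq h^`() 0; last first.
  exists h, 1; rewrite expr1 comp_polyXr; split=> //.
  rewrite irreducible_poly_coprime //; apply/negP => /dvdp_leq -/(_ dh).
  by rewrite leqNgt lt_size_deriv // irredp_neq0.
have [p pF [g hE]] := deriv_eq0_comp dh irr.1.
have p1 : (1 < p)%N by rewrite prime_gt1 // (pcharf_prime pF).
rewrite hE in irr; have irrg := irreducible_comp_Xn (ltnW p1) irr.
have [|g' [n [gE nF cop]]] := IH g _ irrg.
  apply: leq_trans hk; have := size_comp_poly g 'X^p; rewrite -hE size_polyXn /=.
  have := irrg.1; case: (size g) => [|[|s]] //= _; case: (size h) => [|s'] /=.
    by move/eqP; rewrite eq_sym muln_eq0 /= eqn0Ngt (ltnW p1).
  by move=> ->; rewrite ltnS ltn_Pmulr.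
exists g', (n * p)%N; rewrite pnatM nF pnatE ?(pcharf_prime pF) //; split=> //.
by rewrite hE gE -comp_polyA comp_Xn_poly -exprM mulnC.
Qed.

Section FrobeniusTwist.
Variables (R : idomainType) (K : fieldType).
Hypothesis perfectK : perfect_field K.

Lemma perfect_root n (x : K) : [pchar K].-nat n -> exists y, y ^+ n = x.
Proof.
have [k] := ubnP n; elim: k n x => // k IH n x; rewrite ltnS => nk nF.
have [n1|n1] := leqP n 1.
  by exists x; move: nF; case: n n1 {nk} => [|[|]].
have pF : pdiv n \in [pchar K] by apply: (pnatPpi nF); rewrite pi_pdiv.
have p_n := pdiv_dvd n; have [y yx] := perfectK pF x.
have [||z zy] := IH (n %/ pdiv n)%N y.
- apply: leq_trans nk; apply: ltn_Pdiv; first by rewrite prime_gt1 ?pdiv_prime.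
  exact: ltnW.
- by apply: pnat_dvd nF; apply: dvdn_div.
by exists z; rewrite -(divnK p_n) exprM zy.
Qed.

Lemma pchar_nat_expr_inj n : [pchar K].-nat n -> injective (fun x : K => x ^+ n).
Proof.
move=> nF x y /= xy; apply/eqP; rewrite -subr_eq0.
have : (x - y) ^+ n == 0.
  have := exprDn_pchar (x - y) y nF; rewrite subrK xy => /eqP.
  by rewrite -subr_eq subrr eq_sym.
by rewrite expf_eq0 => /andP[].
Qed.

(** [n]-th powers are injective on [K], so taking the unique [n]-th root of [iota r] is additive and
    multiplicative. *)
Lemma frobenius_twist (iota : {rmorphism R -> K}) n :
  [pchar K].-nat n -> is_fraction_field iota ->
  exists2 iota' : {rmorphism R -> K}, is_fraction_field iota' &
    forall r, iota' r ^+ n = iota r.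
Proof.
move=> nF [inj fr]; have := fun r => perfect_root (iota r) nF.
move=> /choice[f fE]; have injn := pchar_nat_expr_inj nF.
have f_add : GRing.zmod_morphism f.
  move=> x y; apply: injn; rewrite fE rmorphB -!fE.
  have := exprDn_pchar (f x - f y) (f y) nF; rewrite subrK => ->.
  by rewrite addrK.
have f_mul : GRing.monoid_morphism f.
  split; first by apply: injn; rewrite fE rmorph1 expr1n.
  by move=> x y; apply: injn; rewrite fE exprMn !fE rmorphM.
pose F : {rmorphism R -> K} := HB.pack f
  (GRing.isZmodMorphism.Build R K f f_add) (GRing.isMonoidMorphism.Build R K f f_mul).
exists F => //; split=> [x y /= xy|x]; first by apply: inj; rewrite -!fE xy.
(* A fraction representing [x ^+ n] for [iota] represents [x] for the twist. *)
have [a [b [b0 xE]]] := fr (x ^+ n); exists a, b; split=> //=.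
by apply: injn; rewrite xE expr_div_n !fE.
Qed.

End FrobeniusTwist.

(** * Generic openness of projections *)

Lemma mpoly_rmorph_ext N (K : comNzRingType) (S : nzRingType)
    (F G : {rmorphism {mpoly K[N]} -> S}) :
  (forall c, F c%:MP = G c%:MP) -> (forall i, F 'X_i = G 'X_i) -> F =1 G.
Proof.
move=> FC FX; elim/mpolyind => [|c m p _ _ Fp]; first by rewrite !rmorph0.
rewrite !rmorphD /= Fp -mul_mpolyC !rmorphM FC mpolyXE_id !rmorph_prod /=.
by congr (_ * _ + _); apply: eq_bigr => i _; rewrite !rmorphXn FX.
Qed.

Definition upd (T : Type) N (b : 'I_N -> T) (i : 'I_N) (t : T) : 'I_N -> T :=
  fun j => if j == i then t else b j.

(* [upoly i f] is [f] as a polynomial in the [i]-th variable; its coefficients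
   stay in the ring of all variables. *)
HB.lock Definition upoly (K : comNzRingType) (N : nat) (i : 'I_N) (f : {mpoly K[N]}) :
    {poly {mpoly K[N]}} :=
  mmap (polyC \o @mpolyC N K) (fun j => if j == i then 'X else ('X_j)%:P) f.

Section Upoly.
Variables (K : comNzRingType) (N : nat) (i : 'I_N).
Local Notation upoly := (@upoly K N i).

Fact upoly_is_zmod_morphism : GRing.zmod_morphism upoly.
Proof. by move=> f g; rewrite unlock rmorphB. Qed.

Fact upoly_is_monoid_morphism : GRing.monoid_morphism upoly.
Proof. by rewrite unlock; split=> [|f g]; rewrite ?rmorph1 ?rmorphM. Qed.

HB.instance Definition _ := GRing.isZmodMorphism.Build _ _ upoly upoly_is_zmod_morphism.
HB.instance Definition _ := GRing.isMonoidMorphism.Build _ _ upoly upoly_is_monoid_morphism.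

Lemma upolyC c : upoly c%:MP = (c%:MP)%:P.
Proof. by rewrite unlock mmapC. Qed.

Lemma upolyX j : upoly 'X_j = if j == i then 'X else ('X_j)%:P.
Proof. by rewrite unlock mmapX mmap1U. Qed.

Lemma upoly_eval (b : 'I_N -> K) t f :
  (map_poly (meval b) (upoly f)).[t] = f.@[upd b i t].
Proof.
rewrite -[LHS]/(horner_eval t (map_poly (meval b) (upoly f))).
apply: (@mpoly_rmorph_ext _ _ _ (horner_eval t \o map_poly (meval b) \o upoly)
          (meval (upd b i t))) => [c|j] /=; rewrite /horner_eval.
  by rewrite upolyC map_polyC hornerC /= !mevalC.
rewrite upolyX mevalXU /upd; case: eqP => _; first by rewrite map_polyX hornerX.
by rewrite map_polyC hornerC /= mevalXU.
Qed.

Lemma upoly_X f : (upoly f).['X_i] = f.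
Proof.
apply: (@mpoly_rmorph_ext _ _ _ (horner_eval 'X_i \o upoly) idfun)
  => [c|j] /=; rewrite /horner_eval; first by rewrite upolyC hornerC.
by rewrite upolyX; case: eqP => [->|_]; rewrite ?hornerX ?hornerC.
Qed.

End Upoly.

Lemma mk_prime_ideal (A : comNzRingType) (q : set A) :
  q 0 -> ~ q 1 -> (forall u v, q u -> q v -> q (u + v)) ->
  (forall a u, q u -> q (a * u)) ->
  (forall u v, q (u * v) -> q u \/ q v) -> prime_ideal q.
Proof.
move=> q0 q1 qD qM qP; split.
  split; rewrite ?inE //; first by apply/negP; rewrite inE.
  by move=> a u v; rewrite !inE => qu qv; apply: (qD) => //; apply: qM.
by move=> u v; rewrite !inE => /qP[] ?; apply/orP; [left|right]; rewrite inE.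
Qed.

(** With [U] the restriction to the line over the residue field, this is the prime of a closed point
    of that line; the next lemma gives its generic point. *)
Lemma dvd_prime_ideal (A : comNzRingType) (F : fieldType)
    (U : {rmorphism A -> {poly F}}) (p : {poly F}) : irreducible_poly p ->
  prime_ideal [set f | p %| U f].
Proof.
move=> irr; apply: mk_prime_ideal => /=.
- by rewrite rmorph0 dvdp0.
- by rewrite rmorph1 dvdp1 => /eqP p1; have := irr.1; rewrite p1.
- by move=> u v pu pv; rewrite rmorphD dvdp_add.
- by move=> a u pu; rewrite rmorphM dvdp_mull.
move=> u v; rewrite rmorphM => puv.
case: (boolP (p %| U u)) => pu; [by left|right].
rewrite -(irreducible_poly_coprime _ irr) in pu.
by rewrite (Gauss_dvdpr _ pu) in puv.
Qed.

Lemma kernel_prime_ideal (A : comNzRingType) (D : idomainType)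
  (U : {rmorphism A -> D}) : prime_ideal [set f | U f = 0].
Proof.
apply: mk_prime_ideal => /=.
- exact: rmorph0.
- by rewrite rmorph1; apply/eqP; rewrite oner_neq0.
- by move=> u v u0 v0; rewrite rmorphD u0 v0 addr0.
- by move=> a u u0; rewrite rmorphM u0 mulr0.
by move=> u v; rewrite rmorphM => /eqP; rewrite mulf_eq0 => /orP[]/eqP; [left|right].
Qed.

Section GenericOpenness.
Variables (R : idomainType) (m : set R) (K : fieldType) (N : nat).
Hypotheses (localR : local_ring m) (henselR : henselian m).
Hypothesis perfectK : perfect_field K.

Definition basic_locus (q : set {mpoly K[N]}) (s : {mpoly K[N]})
    (b : 'I_N -> K) : Prop :=
  (forall f, q f -> f.@[b] = 0) /\ s.@[b] != 0.

Lemma basic_locusM q s s' b : basic_locus q (s * s') b ->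
  basic_locus q s b /\ basic_locus q s' b.
Proof. by case=> qb; rewrite mevalM mulf_eq0 negb_or => /andP[]. Qed.

(* One [s] has to serve every embedding [iota] of [R]: inseparable extensions are
   handled by passing from [iota] to its Frobenius twists. *)
Definition generically_open (X : set ('I_N -> K)) : Prop :=
  forall q, prime_ideal q -> exists2 s, ~ q s &
    forall iota : {rmorphism R -> K}, is_fraction_field iota ->
    forall b, X b -> basic_locus q s b ->
    exists2 lam, lam != 0 & forall b', near iota lam b b' ->
      basic_locus q s b' -> X b'.

Section Projection.
Variables (X : set ('I_N -> K)) (i : 'I_N).
Hypothesis openX : generically_open X.
Variables (q : set {mpoly K[N]}) (L : fieldType).
Variable phi : {rmorphism {mpoly K[N]} -> L}.
Hypotheses (phi0 : forall f, phi f = 0 <-> q f).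
Hypothesis phi_frac : forall x, exists u v, phi v != 0 /\ x = phi u / phi v.

(** Clears denominators. Keeping the size ensures that [phi] does not kill the leading coefficient
    of a lift of a nonzero polynomial. *)
Lemma lift_poly (P : {poly L}) : exists Q d,
  [/\ phi d != 0, map_poly phi Q = phi d *: P & size Q = size P].
Proof.
suff [Q [d [d0 QP]]] : exists Q d, phi d != 0 /\ map_poly phi Q = phi d *: P.
  have E : map_poly phi (\poly_(k < size P) Q`_k) = phi d *: P.
    apply/polyP => k; rewrite -QP !coef_map coef_poly; case: ltnP => // Pk.
    by rewrite raddf0 -coef_map QP coefZ nth_default ?mulr0.
  exists (\poly_(k < size P) Q`_k), d; split=> //.
  apply/eqP; rewrite eqn_leq size_poly /= -[X in (X <= _)%N](size_scale P d0) -E.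
  exact: size_poly.
elim/poly_ind: P => [|P c [Q [d [d0 QP]]]].
  by exists 0, 1; rewrite rmorph1 oner_neq0 rmorph0 scaler0.
have [u [v [v0 ->]]] := phi_frac c.
exists (v%:P * Q * 'X + (d * u)%:P), (d * v); rewrite rmorphM mulf_neq0 //; split=> //.
rewrite rmorphD /= !rmorphM /= map_polyX !map_polyC /= QP.
have vV : (phi v)%:P * ((phi v)^-1)%:P = 1 by rewrite -polyCM divff.
rewrite -!mul_polyC !polyCM; move: vV.
move: (phi v)%:P ((phi v)^-1)%:P (phi d)%:P (phi u)%:P => v1 v2 d1 u1 vV.
by rewrite -[u1 in LHS]mul1r -vV; ring.
Qed.

Lemma map_phi_eq0 (F : {poly {mpoly K[N]}}) b : map_poly phi F = 0 ->
  (forall f, q f -> f.@[b] = 0) -> map_poly (meval b) F = 0.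
Proof.
move=> F0 qb; apply/polyP => k; rewrite coef_map coef0 /=; apply/qb/phi0.
by rewrite -coef_map F0 coef0.
Qed.

(** A Bezout relation over [L], multiplied by its denominators, holds modulo [q]; evaluated at [b]
    and [t] it excludes a common root. *)
Lemma coprime_specialize (A B : {poly {mpoly K[N]}}) :
  coprimep (map_poly phi A) (map_poly phi B) ->
  exists2 d, ~ q d & forall b t, basic_locus q d b ->
    root (map_poly (meval b) A) t -> ~~ root (map_poly (meval b) B) t.
Proof.
move=> /Bezout_eq1_coprimepP[[u v] /= uv].
have [U [d [d0 dU _]]] := lift_poly u; have [V [e [e0 eV _]]] := lift_poly v.
exists (d * e) => [/phi0/eqP|b t [qb deb] At].
  by rewrite rmorphM mulf_eq0 (negPf d0) (negPf e0).
pose F := e%:P * U * A + d%:P * V * B - (d * e)%:P.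
have /map_phi_eq0/(_ qb) : map_poly phi F = 0.
  rewrite rmorphB /= rmorphD /= !rmorphM /= !map_polyC /= dU eV.
  rewrite -!mul_polyC; move: uv.
  move: (phi d)%:P (phi e)%:P => v1 v2 uv.
  by rewrite -[X in _ - X]mulr1 -uv; ring.
rewrite rmorphB /= rmorphD /= !rmorphM /= !map_polyC /=.
move/(congr1 (horner^~ t)); rewrite !hornerE (eqP At) mulr0 add0r.
apply: contra_eqN => /eqP ->; rewrite mulr0 sub0r oppr_eq0 -mevalM.
exact: deb.
Qed.

(** The new [t'] is not asked to be a root of [h]; this makes the property easy to combine over the
    factors of a polynomial. *)
Definition open_over_roots (s : {mpoly K[N]}) (h : {poly {mpoly K[N]}}) : Prop :=
  forall iota : {rmorphism R -> K}, is_fraction_field iota ->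
  forall b t, basic_locus q s b -> root (map_poly (meval b) h) t -> X (upd b i t) ->
  exists2 lam, lam != 0 & forall b', near iota lam b b' ->
    basic_locus q s b' -> exists t', X (upd b' i t').

Lemma near_upd (iota : {rmorphism R -> K}) lam (b b' : 'I_N -> K) t t' :
  near iota lam b b' -> small iota lam (t' - t) ->
  near iota lam (upd b i t) (upd b' i t').
Proof. by move=> nb st j; rewrite /upd; case: eqP. Qed.

Lemma root_upoly (f : {mpoly K[N]}) b t :
  root (map_poly (meval b) (upoly i f)) t = (f.@[upd b i t] == 0).
Proof. by rewrite rootE upoly_eval. Qed.

(** The pseudo-remainder of [F] by [P] is divisible by [P] over [L] and of smaller size, so it
    vanishes over [L]. At [b], a power of the nonzero leading coefficient times [F] is then a
    multiple of [P]. *)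
Lemma divisor_specialize (P : {poly {mpoly K[N]}}) (F : {poly {mpoly K[N]}}) b t :
  size (map_poly phi P) = size P ->
  map_poly phi P %| map_poly phi F ->
  basic_locus q (lead_coef P) b -> root (map_poly (meval b) P) t ->
  root (map_poly (meval b) F) t.
Proof.
move=> sP PF [qb lb] rP.
have := Pdiv.Idomain.divp_eq F P; set D := Pdiv.Idomain.divp _ _ => FE.
have [P0|P0] := eqVneq P 0; first by move: lb; rewrite P0 lead_coef0 meval0 eqxx.
set r := F %% P in FE.
have r0 : map_poly phi r = 0.
  apply/eqP; apply: contraTT (ltn_modpN0 F P0) => r0; rewrite -leqNgt -/r -sP.
  apply: leq_trans (size_poly _ _); apply: dvdp_leq r0 _.
  have -> : r = lead_coef P ^+ scalp F P *: F - D * P by rewrite FE addrC addKr.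
  rewrite rmorphB /= rmorphM /= -mul_polyC rmorphM /=.
  by rewrite dvdp_sub ?dvdp_mull.
have := congr1 (fun p => (map_poly (meval b) p).[t]) FE.
rewrite -mul_polyC !rmorphD /= !rmorphM /= (map_phi_eq0 r0 qb) map_polyC /=.
rewrite rmorphXn !hornerE (eqP rP) mulr0 => /eqP.
by rewrite mulf_eq0 expf_eq0 (negPf lb) andbF.
Qed.

Lemma phi_neq0 f : ~ q f <-> phi f != 0.
Proof. by split=> [nq|/eqP pf /phi0]//; apply/eqP => /phi0. Qed.

Lemma open_over_roots_mul (s s' : {mpoly K[N]}) h :
  open_over_roots s h -> open_over_roots (s * s') h.
Proof.
move=> os iota fr b t /basic_locusM[sb _] rt Xb.
have [lam lam0 H] := os iota fr b t sb rt Xb.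
by exists lam => // b' nb' /basic_locusM[sb' _]; apply: H.
Qed.

Lemma open_over_irreducible_roots (p : {poly L}) : irreducible_poly p ->
  exists P d s, [/\ phi d != 0, map_poly phi P = phi d *: p, ~ q s
    & open_over_roots s P].
Proof.
move=> irr; have [g [n [pE nL cop]]] := irreducible_separable_Xn irr.
have p0 := irredp_neq0 irr; have n0 : (0 < n)%N by case/andP: nL.
have nK : [pchar K].-nat n.
  by rewrite (eq_pnat _ (fmorph_pchar (phi \o @mpolyC N K))) in nL.
have [G [d [d0 GE sG]]] := lift_poly g.
pose P := G \Po 'X^n.
have PE : map_poly phi P = phi d *: p.
  by rewrite map_comp_poly map_polyXn GE comp_polyZ -pE.
have Pp : map_poly phi P %= p by rewrite PE eqp_scale.
have P0 : P != 0.
  by apply: contraNneq p0 => P0; move: Pp; rewrite P0 rmorph0 eqp_sym eqp0.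
have sP : size (map_poly phi P) = size P.
  rewrite PE size_scale // pE -(prednK (n := size (_ \Po _))); last first.
    by rewrite size_poly_gt0 -pE.
  rewrite -[RHS](prednK (n := size P)) ?size_poly_gt0 //.
  by rewrite !size_comp_poly !size_polyXn sG.
have lP : phi (lead_coef P) != 0.
  by rewrite lead_coefE -coef_map -sP -lead_coefE lead_coef_eq0 PE scaler_eq0 negb_or d0.
(* The openness of [X] is used at the closed point [p] of the line over [L], where [s1] does not
   vanish. *)
have [s1 ns1 op] := openX (dvd_prime_ideal (map_poly phi \o upoly i) irr).
have [|d3 nd3 D3] := @coprime_specialize P (upoly i s1).
  by rewrite (eqp_coprimepl _ Pp) irreducible_poly_coprime //; apply/negP.
have [|d4 nd4 D4] := @coprime_specialize G G^`().
  by rewrite -deriv_map GE derivZ coprimepZl // coprimepZr.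
(* [lead_coef P] makes divisibility by [P] specialize, [d3] keeps [s1] nonzero at the roots of [P],
   and [d4] keeps the roots of [G] simple. *)
exists P, d, (lead_coef P * (d3 * d4)); split=> //.
  by rewrite phi_neq0 !rmorphM !mulf_neq0 //; apply/phi_neq0.
have loc b t : basic_locus q (lead_coef P * (d3 * d4)) b ->
    root (map_poly (meval b) P) t ->
    basic_locus [set f | p %| map_poly phi (upoly i f)] s1 (upd b i t).
  move=> /basic_locusM[lb /basic_locusM[b3 _]] rt; split=> [f /= pf|]; last first.
    by rewrite -root_upoly; apply: D3 rt.
  apply/eqP; rewrite -root_upoly.
  by apply: (divisor_specialize sP _ lb rt); rewrite (eqp_dvdl _ Pp).
have rP b t : root (map_poly (meval b) P) t = root (map_poly (meval b) G) (t ^+ n).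
  by rewrite /P map_comp_poly map_polyXn !rootE horner_comp hornerXn.
move=> iota fr b t sb rt Xb.
have [iota' fr' iE] := frobenius_twist perfectK nK fr.
have [lam' lam'0 op'] := op iota' fr' _ Xb (loc _ _ sb rt).
have [_ /basic_locusM[_ b4]] := basic_locusM sb.
have rG : root (map_poly (meval b) G) (t ^+ n) by rewrite -rP.
(* The root of [G] is the [n]-th power of the coordinate, so its target radius is the [n]-th power
   of the radius wanted for [iota']. *)
have [lam lam0 ift] := implicit_function fr localR henselR rG (D4 _ _ b4 rG)
  (expf_neq0 n lam'0).
have [nu nu0 [n1 n2]] := small_cap fr lam0 lam'0.
exists nu => // b' nb sb'.
have [z' [r zE] rz'] := ift b' (near_trans n1 nb).
have [t' t'E] := perfect_root perfectK z' nK.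
exists t'; apply: op'; last by apply: loc => //; rewrite rP t'E.
apply: near_upd.
  (* Since [iota u = iota' (u ^+ n)], closeness for [iota] implies closeness for [iota']. *)
  move=> j; have [u ->] := near_trans n2 nb j; exists (u ^+ n).
  by rewrite rmorphXn /= iE.
(* By additivity of the Frobenius, [(t' - t) ^+ n = z' - t ^+ n = (lam' * iota' r) ^+ n]. *)
exists r; apply: (pchar_nat_expr_inj nK) => /=.
rewrite exprMn iE -zE -t'E.
have := exprDn_pchar (t' - t) t nK; rewrite subrK => ->.
by rewrite addrK.
Qed.

(** Induction on the degree over [L], splitting off an irreducible factor; modulo [q] and up to
    denominators [h] is the product of the two lifts. A nonzero constant has no roots over the
    locus. *)
Lemma open_over_roots_exists h : map_poly phi h != 0 ->
  exists2 s, ~ q s & open_over_roots s h.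
Proof.
have [k] := ubnP (size (map_poly phi h)); elim: k h => // k IH h; rewrite ltnS => hk h0.
have [h1|h1] := leqP (size (map_poly phi h)) 1.
  have hC := size1_polyC h1; rewrite coef_map /= in hC.
  exists h`_0; first by apply/phi_neq0; apply: contraNneq h0 => E; rewrite hC E.
  move=> iota fr b t [qb hb] rt.
  have /map_phi_eq0/(_ qb) : map_poly phi (h - (h`_0)%:P) = 0.
    by rewrite rmorphB /= map_polyC /= {1}hC subrr.
  move/(congr1 (horner^~ t)); rewrite rmorphB /= map_polyC !hornerE (eqP rt).
  by rewrite sub0r => /eqP; rewrite oppr_eq0 (negPf hb).
have [p irr ph] := irreducible_divisor h1.
have [P [d [s [d0 PE ns os]]]] := open_over_irreducible_roots irr.
set H := map_poly phi h in h0 hk ph.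
have [H2 [e [e0 H2E sH2]]] := lift_poly (H %/ p).
have HE : H = H %/ p * p by rewrite divpK.
have quo0 : H %/ p != 0 by apply: contraNneq h0 => E; rewrite HE E mul0r.
have [||s2 ns2 os2] := IH H2.
- apply: leq_trans hk; rewrite H2E size_scale // size_divp ?irredp_neq0 //.
  rewrite ltn_subrL ltn_predRL irr.1 /= size_poly_gt0 //.
- by rewrite H2E scaler_eq0 negb_or e0.
exists (s * s2); first by apply/phi_neq0; rewrite rmorphM mulf_neq0 //; apply/phi_neq0.
have os' := open_over_roots_mul (s' := s2) os.
have os2' := open_over_roots_mul (s' := s) os2.
rewrite mulrC in os2'.
move=> iota fr b t sb rt Xb; have [qb _] := sb.
have /map_phi_eq0/(_ qb) : map_poly phi ((d * e) *: h - P * H2) = 0.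
  rewrite rmorphB /= -mul_polyC !rmorphM /= !map_polyC /= PE H2E -/H.
  rewrite -!mul_polyC; move: HE; move: (H %/ p) => A ->.
  by move: (phi d)%:P (phi e)%:P => d' e'; ring.
move/(congr1 (horner^~ t)); rewrite rmorphB /= -mul_polyC !rmorphM /=.
rewrite !hornerE (eqP rt) mulr0 sub0r => /eqP; rewrite oppr_eq0 mulf_eq0.
by case/orP => r; [apply: os' r Xb|apply: os2' r Xb].
Qed.

(** [qt] is the generic point of the line over [L]. Where [st] is nonzero the same [t] serves for
    all nearby [b']; elsewhere [t] is a root of a polynomial that is nonzero over [L]. *)
Lemma generic_projection : exists2 s, ~ q s &
  forall iota : {rmorphism R -> K}, is_fraction_field iota ->
  forall b t, X (upd b i t) -> basic_locus q s b ->
  exists2 lam, lam != 0 & forall b', near iota lam b b' ->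
    basic_locus q s b' -> exists t', X (upd b' i t').
Proof.
pose qt : set {mpoly K[N]} := [set f | map_poly phi (upoly i f) = 0].
have prime_qt : prime_ideal qt := kernel_prime_ideal (map_poly phi \o upoly i).
have [st nst op] := openX prime_qt.
have [|s ns os] := @open_over_roots_exists (upoly i st); first exact/eqP.
exists s => // iota fr b t Xb sb.
have [r0|nr] := boolP (root (map_poly (meval b) (upoly i st)) t).
  exact: os sb r0 Xb.
have loc b' t' : basic_locus q s b' -> forall f, qt f -> f.@[upd b' i t'] = 0.
  move=> [qb' _] f qf; apply/eqP; rewrite -root_upoly (map_phi_eq0 qf qb').
  by rewrite root0.
rewrite root_upoly in nr.
have [lam lam0 H] := op iota fr _ Xb (conj (loc _ _ sb) nr).
have [p mp p0] := max_ideal_neq0 localR.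
(* With this radius [st] is only multiplied by a unit [1 + p r], so it stays nonzero. *)
have c0 : st.@[upd b i t] * iota p != 0 by rewrite mulf_neq0 // (iota_eq0 fr).
have [mu mu0 H'] := meval_continuous fr st (upd b i t) c0.
have [nu nu0 Hnu] := near_cap fr N lam0 mu0.
exists nu => // b' nb sb'; exists t.
have nbt : near iota nu (upd b i t) (upd b' i t).
  by apply: near_upd => //; rewrite subrr; apply: small0.
have [n1 n2] := Hnu _ _ nbt.
apply: (H _ n1); split; first exact: (loc _ _ sb').
have [r rE] := H' _ n2; have [u eu] := unit_1D localR henselR (max_idealMl localR r mp).
apply/eqP => st0; move: rE; rewrite st0 sub0r => /eqP; rewrite eq_sym -subr_eq0 opprK.
rewrite -mulrA -rmorphM -{2}[_.@[_]]mulr1 -(rmorph1 iota) -mulrDr -rmorphD.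
rewrite mulf_eq0 (negPf nr) (iota_eq0 fr) /= => /eqP E.
move/eqP: eu; rewrite [_ * r]mulrC in E; rewrite addrC E mul0r eq_sym.
by rewrite (negPf (oner_neq0 _)).
Qed.

End Projection.

Lemma generically_open_exists (X : set ('I_N -> K)) (i : 'I_N) :
  generically_open X -> generically_open [set b | exists t, X (upd b i t)].
Proof.
move=> openX q prime_q; have [L [phi [phi0 phi_frac]]] := residue_field prime_q.
have [s ns H] := generic_projection i openX phi0 phi_frac.
by exists s => // iota fr b [t Xt] sb; apply: H Xt sb.
Qed.

End GenericOpenness.

Section PrimeIdealFacts.
Variables (A : comNzRingType) (q : set A) (prime_q : prime_ideal q).

Lemma prime_ideal0 : q 0.
Proof. by case: prime_q => -[]; rewrite inE. Qed.

Lemma prime_ideal1 : ~ q 1.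
Proof. by case: prime_q => -[_ /negP + _] _ => + q1; apply; rewrite inE. Qed.

Lemma prime_idealMl a u : q u -> q (a * u).
Proof.
move=> qu; case: prime_q => -[_ _ /(_ a u 0)] + _; rewrite !inE addr0.
by apply=> //; apply: prime_ideal0.
Qed.

Lemma prime_idealMr a u : q u -> q (u * a).
Proof. by rewrite mulrC; apply: prime_idealMl. Qed.

Lemma prime_idealD u v : q u -> q v -> q (u + v).
Proof.
move=> qu qv; case: prime_q => -[_ _ /(_ 1 u v)] + _; rewrite !inE mul1r.
exact.
Qed.

Lemma prime_idealP u v : q (u * v) -> q u \/ q v.
Proof.
case: prime_q => _ /(_ u v); rewrite !inE => + quv => /(_ quv) /orP[].
  by rewrite inE; left.
by rewrite inE; right.
Qed.

Lemma prime_ideal_mul_notin u v : ~ q u -> ~ q v -> ~ q (u * v).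
Proof. by move=> nu nv /prime_idealP[]. Qed.

Lemma prime_ideal_pow_notin u k : ~ q u -> ~ q (u ^+ k).
Proof.
move=> nu; elim: k => [|k IH]; first by rewrite expr0; apply: prime_ideal1.
by rewrite exprS; apply: prime_ideal_mul_notin.
Qed.

End PrimeIdealFacts.

Lemma prime_ideal_preim (A B : comNzRingType) (f : {rmorphism A -> B}) (q : set B) :
  prime_ideal q -> prime_ideal [set a | q (f a)].
Proof.
move=> pq; apply: mk_prime_ideal => /=.
- by rewrite rmorph0; apply: prime_ideal0.
- by rewrite rmorph1; apply: prime_ideal1.
- by move=> u v qu qv; rewrite rmorphD; apply: prime_idealD.
- by move=> a u qu; rewrite rmorphM; apply: prime_idealMl.
by move=> u v; rewrite rmorphM; apply: prime_idealP.
Qed.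

(** * Existential formulas as iterated projections *)

Section ExistentialSets.
Variables (R : idomainType) (m : set R) (K : fieldType).
Hypotheses (localR : local_ring m) (henselR : henselian m).
Hypothesis perfectK : perfect_field K.

Definition env N (b : 'I_N -> K) : seq K := [tuple b j | j < N].

Lemma nth_env N (b : 'I_N -> K) k (kN : (k < N)%N) : (env b)`_k = b (Ordinal kN).
Proof. exact: (nth_mktuple b 0 (Ordinal kN)). Qed.

Lemma nth_env_default N (b : 'I_N -> K) k : (N <= k)%N -> (env b)`_k = 0.
Proof. by move=> Nk; rewrite nth_default // size_tuple. Qed.

Lemma term_poly N (t : GRing.term K) : GRing.rterm t ->
  exists p : {mpoly K[N]}, forall b, GRing.eval (env b) t = p.@[b].
Proof.
elim: t => //=.
- move=> k _; case: (ltnP k N) => kN; last first.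
    by exists 0 => b; rewrite meval0 nth_env_default.
  by exists 'X_(Ordinal kN) => b; rewrite mevalXU nth_env.
- by move=> c _; exists c%:MP => b; rewrite mevalC.
- by move=> k _; exists (k%:R%:MP) => b; rewrite mevalC.
- move=> t1 IH1 t2 IH2 /andP[/IH1[p1 E1] /IH2[p2 E2]].
  by exists (p1 + p2) => b; rewrite mevalD E1 E2.
- by move=> t IH /IH[p E]; exists (- p) => b; rewrite mevalN E.
- by move=> t IH k /IH[p E]; exists (p *+ k) => b; rewrite mevalMn E.
- move=> t1 IH1 t2 IH2 /andP[/IH1[p1 E1] /IH2[p2 E2]].
  by exists (p1 * p2) => b; rewrite mevalM E1 E2.
by move=> t IH k /IH[p E]; exists (p ^+ k) => b; rewrite rmorphXn /= E.
Qed.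

(** An equation is decided at the generic point: either the difference of its sides is in [q] and
    vanishes throughout, or that difference is taken as [s]. *)
Lemma qf_form_generic N (f : GRing.formula K) (q : set {mpoly K[N]}) :
  prime_ideal q -> GRing.qf_form f -> GRing.rformula f ->
  exists2 s, ~ q s & exists h : bool, forall b, basic_locus q s b ->
    (GRing.holds (env b) f <-> h).
Proof.
move=> pq; have n1 := prime_ideal1 pq.
have bin f1 f2 (op : Prop -> Prop -> Prop) (opb : bool -> bool -> bool) :
    (forall (P Q : Prop) (h1 h2 : bool), (P <-> h1) -> (Q <-> h2) ->
      (op P Q <-> opb h1 h2)) ->
    (exists2 s, ~ q s & exists h : bool, forall b, basic_locus q s b ->
      (GRing.holds (env b) f1 <-> h)) ->
    (exists2 s, ~ q s & exists h : bool, forall b, basic_locus q s b ->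
      (GRing.holds (env b) f2 <-> h)) ->
    exists2 s, ~ q s & exists h : bool, forall b, basic_locus q s b ->
      (op (GRing.holds (env b) f1)
          (GRing.holds (env b) f2) <-> h).
  move=> opP [s1 ns1 [h1 H1]] [s2 ns2 [h2 H2]]; exists (s1 * s2).
    exact: prime_ideal_mul_notin.
  by exists (opb h1 h2) => b /basic_locusM[/H1 ? /H2 ?]; apply: opP.
elim: f => //=.
- by move=> h _ _; exists 1 => //; exists h.
- move=> t1 t2 _ /andP[/(term_poly N)[p1 E1] /(term_poly N)[p2 E2]].
  have [qp|nqp] := pselect (q (p1 - p2)).
    exists 1 => //; exists true => b [/(_ _ qp) /eqP + _].
    by rewrite mevalB subr_eq0 E1 E2 => /eqP.
  exists (p1 - p2) => //; exists false => b [_].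
  by rewrite mevalB subr_eq0 E1 E2 => /eqP.
- move=> f1 IH1 f2 IH2 /andP[q1 q2] /andP[r1 r2].
  apply: (bin _ _ and andb); auto => P Q h1 h2 [a1 b1] [a2 b2].
  by split=> [[/a1-> /a2->]//|/andP[/b1 ? /b2 ?]].
- move=> f1 IH1 f2 IH2 /andP[q1 q2] /andP[r1 r2].
  apply: (bin _ _ or orb); auto => P Q h1 h2 [a1 b1] [a2 b2].
  split=> [[/a1->//|/a2->]|/orP[/b1|/b2]]; [exact: orbT|exact: or_introl|exact: or_intror].
- move=> f1 IH1 f2 IH2 /andP[q1 q2] /andP[r1 r2].
  apply: (bin _ _ (fun P Q => P -> Q) implb); auto => P Q h1 h2 [a1 b1] [a2 b2].
  by split=> [PQ|/implyP H /a1/H/b2//]; apply/implyP => /b1/PQ/a2.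
move=> f IH qf rf; have [s ns [h H]] := IH qf rf.
exists s => //; exists (~~ h) => b /H[a1 b1]; split=> [nf|/negP nh /a1//].
by apply/negP => /b1.
Qed.

(** Bound variables remain coordinates, and a quantifier overwrites its coordinate, so the dimension
    never changes. Without quantifiers the truth value is constant on the locus and any radius
    works. *)
Lemma exists_generically_open N (s : seq nat) (f : GRing.formula K) :
  GRing.qf_form f -> GRing.rformula f -> all (fun i => i < N)%N s ->
  generically_open R [set b : 'I_N -> K |
    GRing.holds (env b) (foldr GRing.Exists f s)].
Proof.
move=> qf rf; elim: s => [_|i s IH /andP[iN /IH{}IH]].
  move=> q pq; have [s ns [h H]] := qf_form_generic pq qf rf.
  exists s => // iota fr b /= Xb sb; exists 1 => [|b' _ sb']; first exact: oner_neq0.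
  by apply/(H _ sb'); apply/(H _ sb).
have := generically_open_exists localR henselR perfectK (Ordinal iN) IH.
have E b t : GRing.same_env (env (upd b (Ordinal iN) t)) (set_nth 0 (env b) i t).
  move=> k; rewrite nth_set_nth /=; case: (ltnP k N) => kN.
    by rewrite !nth_env /upd.
  rewrite !nth_env_default //; case: eqP => // ki.
  by move: kN; rewrite ki leqNgt iN.
set Y := [set b | _]; set Z := [set b | _]; suff -> : Y = Z by [].
apply/seteqP; split=> b [t Ht]; exists t; first exact: GRing.eq_holds (E b t) Ht.
exact: GRing.eq_holds (GRing.same_env_sym (E b t)) Ht.
Qed.

(** Quantified indices may exceed [n]. Missing variables are read as 0, hence the extension by
    zeros; [unpad] is the dual map on polynomials. *)
Definition pad n N (a : 'I_n -> K) (j : 'I_N) : K :=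
  if insub (val j) is Some i then a i else 0.

Definition unpad n N : {mpoly K[N]} -> {mpoly K[n]} :=
  mmap (@mpolyC n K) (fun j => if insub (val j) is Some i then 'X_i else 0).
HB.instance Definition _ n N := GRing.RMorphism.on (@unpad n N).

Lemma meval_unpad n N (f : {mpoly K[N]}) (a : 'I_n -> K) :
  (unpad n f).@[a] = f.@[pad a].
Proof.
apply: (@mpoly_rmorph_ext _ _ _ (meval a \o @unpad n N) (meval (pad a))) => [c|j] /=.
  by rewrite /unpad mmapC !mevalC.
rewrite /unpad mmapX mmap1U mevalXU /pad.
by case: insub => [i|]; rewrite ?mevalXU ?meval0.
Qed.

Lemma existential_generically_open n (X : set (n.-tuple K)) :
  existentially_definable X ->
  generically_open R [set a : 'I_n -> K | X [tuple a j | j < n]].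
Proof.
move=> [s [f [qf rf ->]]] q pq.
pose N := (n + (\max_(i <- s) i).+1)%N.
have sN : all (fun i => i < N)%N s.
  apply/allP => i si; apply: leq_trans (leq_addl _ _); rewrite ltnS.
  by rewrite (big_rem i) //= leq_maxl.
(* [q] is transported to the larger space along the embedding by zeros. *)
have [s1 ns1 H] := exists_generically_open qf rf sN (prime_ideal_preim (@unpad n N) pq).
have padE (a : 'I_n -> K) : GRing.same_env (env (pad (N := N) a)) [tuple a j | j < n].
  move=> k; case: (ltnP k n) => kn; last first.
    rewrite [RHS]nth_default ?size_tuple //; case: (ltnP k N) => kN.
      by rewrite nth_env /pad insubN // -leqNgt.
    by rewrite nth_env_default.
  have kN : (k < N)%N by apply: leq_trans (leq_addr _ _).
  rewrite nth_env -[RHS]/((env a)`_k) nth_env /pad insubT.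
  by [].
have loc a : basic_locus q (unpad n s1) a ->
    basic_locus [set f | q (unpad n f)] s1 (pad a).
  move=> [qa sa]; split=> [g qg|]; last by rewrite -meval_unpad.
  by rewrite -meval_unpad; apply: qa.
exists (unpad n s1) => // iota fr a Xa sa.
have [|lam lam0 H'] := H iota fr (pad a) _ (loc _ sa).
  exact: GRing.eq_holds (GRing.same_env_sym (padE a)) Xa.
exists lam => // a' na' sa'.
apply: (GRing.eq_holds (padE a')); apply: H'; last exact: loc.
by move=> j; rewrite /pad; case: insub => [i|]; [exact: na'|rewrite subrr; exact: small0].
Qed.

End ExistentialSets.

(** * Generic smoothness *)

Section FreeVariables.
Variables (K : fieldType) (n : nat).
Local Notation A := {mpoly K[n]}.
Implicit Types (i j : 'I_n) (f g : A).

(** Independence of a variable is being fixed by this ring morphism, so its stability under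
    algebraic operations reduces to commutation. *)
Definition kill i : A -> A :=
  mmap (@mpolyC n K) (fun j => if j == i then 0 else 'X_j).
HB.instance Definition _ i := GRing.RMorphism.on (kill i).

Lemma killC i c : kill i c%:MP = c%:MP.
Proof. exact: mmapC. Qed.

Lemma killX i j : kill i 'X_j = if j == i then 0 else 'X_j.
Proof. by rewrite /kill mmapX mmap1U. Qed.

Definition free i f : Prop := kill i f = f.

Lemma kill_mnm i (m : 'X_{1..n}) : kill i 'X_[m] = if m i == 0%N then 'X_[m] else 0.
Proof.
rewrite {1}mpolyXE_id rmorph_prod /=; case: ifPn => [/eqP mi|mi]; last first.
  by rewrite (bigD1 i) //= rmorphXn /= killX eqxx expr0n (negPf mi) mul0r.
rewrite [RHS]mpolyXE_id; apply: eq_bigr => j _; rewrite rmorphXn /= killX.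
by case: eqP => // ->; rewrite mi !expr0.
Qed.

Lemma mcoeff_kill i f m : (kill i f)@_m = if m i == 0%N then f@_m else 0.
Proof.
elim/mpolyind: f => [|c k f _ _ IH]; first by rewrite rmorph0 mcoeff0 if_same.
rewrite rmorphD /= -mul_mpolyC rmorphM /= killC kill_mnm !mul_mpolyC !mcoeffD IH.
rewrite !mcoeffZ (fun_if (mcoeff m)) mcoeff0 mcoeffX.
case: (eqVneq k m) => [->|km]; first by case: ifP => _; rewrite ?mulr0 ?addr0.
by rewrite if_same mulr0 !add0r.
Qed.

Lemma freeP i f : free i f <-> forall m : 'X_{1..n}, m i != 0%N -> f@_m = 0.
Proof.
split=> [<- m mi|H]; first by rewrite mcoeff_kill (negPf mi).
by apply/mpolyP => m; rewrite mcoeff_kill; case: eqP => // /eqP/H.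
Qed.

Lemma free_mderiv_eq0 i f : free i f -> f^`M(i) = 0.
Proof.
move/freeP => H; apply/mpolyP => m; rewrite mcoeff_deriv H ?mul0rn ?mcoeff0 //.
by rewrite mnmDE mnm1E eqxx addn1.
Qed.

Lemma free_mderiv i j f : free j f -> free j f^`M(i).
Proof.
move/freeP => H; apply/freeP => m mj; rewrite mcoeff_deriv H ?mul0rn //.
by rewrite mnmDE addn_eq0 negb_and mj.
Qed.

Lemma map_kill_upoly i f : map_poly (kill i) (upoly i f) = upoly i f.
Proof.
apply: (@mpoly_rmorph_ext _ _ _ (map_poly (kill i) \o @upoly _ _ i) (@upoly _ _ i))
  => [c|j] /=; first by rewrite upolyC map_polyC /= killC.
rewrite upolyX; case: (eqVneq j i) => [_|ji]; first by rewrite map_polyX.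
by rewrite map_polyC /= killX (negPf ji).
Qed.

Lemma map_kill_upoly_neq i j f : j != i ->
  map_poly (kill j) (upoly i f) = upoly i (kill j f).
Proof.
move=> ji; apply: (@mpoly_rmorph_ext _ _ _ (map_poly (kill j) \o @upoly _ _ i)
   (@upoly _ _ i \o kill j)) => [c|k] /=.
  by rewrite killC upolyC map_polyC /= killC.
rewrite upolyX killX; case: (eqVneq k i) => [->|ki].
  by rewrite map_polyX eq_sym (negPf ji) upolyX eqxx.
rewrite map_polyC /= killX; case: eqP => _; first by rewrite polyC0 rmorph0.
by rewrite upolyX (negPf ki).
Qed.

Lemma free_upoly i f : free i f -> upoly i f = f%:P.
Proof.
move=> fi; rewrite -fi.
apply: (@mpoly_rmorph_ext _ _ _ (@upoly _ _ i \o kill i) (polyC \o kill i)) => [c|j] /=.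
  by rewrite killC upolyC.
rewrite killX; case: eqP => [_|/eqP ji]; first by rewrite rmorph0 polyC0.
by rewrite upolyX (negPf ji).
Qed.

Lemma free_coef_upoly i j f k : free j f \/ j = i -> free j (upoly i f)`_k.
Proof.
move=> H; have E : map_poly (kill j) (upoly i f) = upoly i f.
  have [->|ji] := eqVneq j i; first exact: map_kill_upoly.
  case: H => [fj|/eqP]; last by rewrite (negPf ji).
  by rewrite (map_kill_upoly_neq _ ji) fj.
by rewrite /free -[in RHS]E coef_map.
Qed.

Lemma upoly_hornerX i (P : {poly A}) :
  map_poly (kill i) P = P -> upoly i P.['X_i] = P.
Proof.
move=> Pi; rewrite -horner_map /= upolyX eqxx.
suff -> : map_poly (upoly i) P = map_poly polyC P.
  by rewrite -/(P \Po 'X) comp_polyXr.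
apply/polyP => k; rewrite !coef_map /= free_upoly //.
by rewrite /free -coef_map /= Pi.
Qed.

Definition only_in (S : pred 'I_n) f : Prop := forall j, ~~ S j -> free j f.

Lemma only_in_hornerX (S : pred 'I_n) i (P : {poly A}) : S i ->
  (forall j, ~~ S j -> map_poly (kill j) P = P) -> only_in S P.['X_i].
Proof.
move=> Si H j Sj; rewrite /free -horner_map /= H // killX.
by case: eqP => // ij; rewrite -ij Si in Sj.
Qed.

(** Quotient and remainder are unique for the given multiplier, so every [kill j] fixing the data
    fixes them too, and no new variable enters. *)
Lemma pseudo_division (S : pred 'I_n) i f g : S i -> only_in S f -> only_in S g ->
  upoly i g != 0 ->
  exists k u r, [/\ only_in S r, lead_coef (upoly i g) ^+ k * f = u * g + r
    & (size (upoly i r) < size (upoly i g))%N].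
Proof.
move=> Si Sf Sg; set F := upoly i f; set G := upoly i g => G0.
have := Pdiv.Idomain.divp_eq F G; set k := Pdiv.Idomain.scalp _ _; set D := Pdiv.Idomain.divp _ _.
set r := F %% G => FE.
have sr : (size r < size G)%N by apply: (ltn_modpN0 F G0).
have stable j : map_poly (kill j) F = F -> map_poly (kill j) G = G ->
    map_poly (kill j) D = D /\ map_poly (kill j) r = r.
  move=> Fj Gj; have lj : kill j (lead_coef G) = lead_coef G.
    by rewrite lead_coefE -coef_map /= Gj.
  have FEj : lead_coef G ^+ k *: F = map_poly (kill j) D * G + map_poly (kill j) r.
    rewrite -{2}Gj -rmorphM -rmorphD -FE -!mul_polyC rmorphM /= map_polyC /=.
    by rewrite (rmorphXn (kill j)) /= lj Fj.
  have E : (D - map_poly (kill j) D) * G = map_poly (kill j) r - r.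
    apply/eqP; rewrite mulrBl subr_eq addrAC eq_sym subr_eq addrC -FEj FE addrC.
    by rewrite eqxx.
  have : D - map_poly (kill j) D = 0.
    apply/eqP; apply: contraTT (leqnn (size G)) => D0; rewrite -ltnNge.
    apply: (@leq_ltn_trans (size ((D - map_poly (kill j) D) * G))).
      move: (D0); rewrite size_mul // -size_poly_gt0.
      by case: (size (D - map_poly (kill j) D)) => // s _; rewrite addSn leq_addl.
    rewrite E (leq_ltn_trans (size_polyD _ _)) // size_polyN gtn_max sr andbT.
    by apply: leq_ltn_trans (size_poly _ _) sr.
  move=> D0; split; first by apply/esym/eqP; rewrite -subr_eq0 D0.
  by apply/eqP; rewrite -subr_eq0 -E D0 mul0r.
have Fi := map_kill_upoly i f; have Gi := map_kill_upoly i g.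
exists k, D.['X_i], r.['X_i]; split.
- apply: (only_in_hornerX Si) => j Sj.
  have ji : j != i by apply: contraNneq Sj => ->.
  have Fj : map_poly (kill j) F = F by rewrite /F (map_kill_upoly_neq f ji) (Sf _ Sj).
  have Gj : map_poly (kill j) G = G by rewrite /G (map_kill_upoly_neq g ji) (Sg _ Sj).
  exact: (stable j Fj Gj).2.
- rewrite -(upoly_X i f) -[g](upoly_X i g) -/F -/G -hornerM -hornerD -FE.
  by rewrite hornerZ.
by rewrite (upoly_hornerX (stable i Fi Gi).2).
Qed.

End FreeVariables.

Section IdealSpan.
Variables (A : comNzRingType) (S : set A).

Lemma ideal_span_mem f : S f -> ideal_span S f.
Proof.
by move=> Sf; exists 1, (fun=> 1), (fun=> f); split=> //; rewrite big_ord1 mul1r.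
Qed.

Lemma ideal_span0 : ideal_span S 0.
Proof.
exists 0%N, (fun=> 0), (fun=> 0); split=> [[]//|].
by rewrite big_ord0.
Qed.

Lemma ideal_spanMl a f : ideal_span S f -> ideal_span S (a * f).
Proof.
move=> [l [c [g [Sg ->]]]]; exists l, (fun k => a * c k), g; split=> //.
by rewrite mulr_sumr; apply: eq_bigr => k _; rewrite mulrA.
Qed.

Lemma ideal_spanD f g : ideal_span S f -> ideal_span S g -> ideal_span S (f + g).
Proof.
move=> [l [c [u [Su ->]]]] [l' [c' [u' [Su' ->]]]].
pose glue (a : 'I_l -> A) (a' : 'I_l' -> A) (k : 'I_(l + l')) :=
  match split k with inl i => a i | inr i => a' i end.
exists (l + l')%N, (glue c c'), (glue u u'); split.
  by move=> k; rewrite /glue; case: (split k) => i.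
rewrite big_split_ord; congr (_ + _); apply: eq_bigr => k _.
  by rewrite /glue (unsplitK (inl k)).
by rewrite /glue (unsplitK (inr k)).
Qed.

Lemma ideal_span_sum (I : Type) (r : seq I) (F : I -> A) :
  (forall i, ideal_span S (F i)) -> ideal_span S (\sum_(i <- r) F i).
Proof. by move=> H; elim/big_ind: _ => //; [apply: ideal_span0|apply: ideal_spanD]. Qed.

Lemma ideal_span_sub (I : set A) f :
  I 0 -> (forall u v, I u -> I v -> I (u + v)) -> (forall a u, I u -> I (a * u)) ->
  S `<=` I -> ideal_span S f -> I f.
Proof.
move=> I0 ID IM SI [l [c [g [Sg ->]]]].
by elim/big_ind: _ => // k _; apply/IM/SI.
Qed.

End IdealSpan.

(** * Local equations by elimination of variables *)

Section GenericSmoothness.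
Variables (K : fieldType) (n : nat).
Local Notation A := {mpoly K[n]}.
Hypothesis perfectK : perfect_field K.
Variables (q : set A) (prime_q : prime_ideal q).
Variables (L : fieldType) (phi : {rmorphism A -> L}).
Hypothesis phi0 : forall f, phi f = 0 <-> q f.

Implicit Types (f : A) (v : 'I_n -> L).

Definition jacobian c (g : 'I_c -> A) (h : 'I_c -> 'I_n) : 'M[A]_c :=
  \matrix_(i < c, j < c) mderiv (h j) (g i).

(** The derivation over [phi] that sends [X_i] to [v i]. *)
Definition dvar (v : 'I_n -> L) (f : A) : L := \sum_i phi f^`M(i) * v i.

Lemma dvarD v f g : dvar v (f + g) = dvar v f + dvar v g.
Proof.
by rewrite /dvar -big_split; apply: eq_bigr => i _; rewrite mderivD rmorphD mulrDl.
Qed.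

Lemma dvar0 v : dvar v 0 = 0.
Proof. by rewrite /dvar big1 // => i _; rewrite mderiv0 rmorph0 mul0r. Qed.

Lemma dvar_sum v (I : Type) (r : seq I) (F : I -> A) :
  dvar v (\sum_(i <- r) F i) = \sum_(i <- r) dvar v (F i).
Proof. exact: (big_morph _ (dvarD v) (dvar0 v)). Qed.

Lemma dvarM v f g : dvar v (f * g) = phi f * dvar v g + phi g * dvar v f.
Proof.
rewrite /dvar !mulr_sumr -big_split; apply: eq_bigr => i _ /=.
by rewrite mderivM rmorphD !rmorphM /=; ring.
Qed.

Lemma dvarM0 v f g : q g -> dvar v (f * g) = phi f * dvar v g.
Proof. by move=> /phi0 g0; rewrite dvarM g0 mul0r addr0. Qed.

Definition delta (i : 'I_n) : 'I_n -> L := fun j => (j == i)%:R.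

Lemma dvar_delta i f : dvar (delta i) f = phi f^`M(i).
Proof.
rewrite /dvar (bigD1 i) //= big1 /delta ?eqxx ?mulr1 ?addr0 // => j /negPf ->.
by rewrite mulr0.
Qed.

Lemma dvar_lin v w a f : dvar (fun i => v i + a * w i) f = dvar v f + a * dvar w f.
Proof.
rewrite /dvar mulr_sumr -big_split; apply: eq_bigr => i _ /=; ring.
Qed.

Lemma upoly_expand y f : f = \sum_(k < size (upoly y f)) 'X_y ^+ k * (upoly y f)`_k.
Proof.
rewrite -[LHS](upoly_X y) horner_coef; apply: eq_bigr => k _.
by rewrite mulrC.
Qed.

(** In the Leibniz rule, the terms that differentiate a power of [X_y] carry a coefficient lying in
    [q]. *)
Lemma dvar_vanishing v y f : map_poly phi (upoly y f) = 0 ->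
  dvar v f = \sum_(k < size (upoly y f)) phi 'X_y ^+ k * dvar v (upoly y f)`_k.
Proof.
move=> f0; rewrite {1}(upoly_expand y f) dvar_sum; apply: eq_bigr => k _.
rewrite dvarM0 ?rmorphXn //; apply/phi0.
by have := coef_map phi (upoly y f) k; rewrite f0 coef0 => <-.
Qed.

Lemma coef_vanishing y f k : map_poly phi (upoly y f) = 0 -> q (upoly y f)`_k.
Proof.
move=> f0; apply/phi0; have := coef_map phi (upoly y f) k.
by rewrite f0 coef0 => <-.
Qed.

(** Local generation of the part of [q] in the variables [S] by equations with independent
    differentials. The exponent depends on [f] because each elimination brings in a power of a
    leading coefficient. *)
Definition triangular (S : pred 'I_n) : Prop :=
  exists c (g : 'I_c -> A) (h : 'I_c -> 'I_n) s,
  [/\ forall i, q (g i) /\ only_in S (g i), ~ q (\det (jacobian g h)), ~ q s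
    & forall f, q f -> only_in S f -> exists k, ideal_span (range g) (s ^+ k * f)].

Definition rigid (S : pred 'I_n) (ys : seq 'I_n) : Prop := forall v : 'I_n -> L,
  (forall i, i \notin ys -> v i = 0) ->
  (forall f, q f -> only_in S f -> dvar v f = 0) -> forall i, v i = 0.

(* [rigid S ys] says that every derivation of the field generated by the variables
   in [S] that kills those outside [ys] is zero. It forces the last variable [y] to
   be separable over the others, so that derivations extend along it and rigidity
   descends to [ys]. *)
Lemma triangular_step (B : pred 'I_n) y ys :
  let S := [pred i | B i || (i \in y :: ys)] in
  let S' := [pred i | B i || (i \in ys)] in
  ~~ B y -> y \notin ys -> rigid S (y :: ys) ->
  rigid S' ys /\ (triangular S' -> triangular S).
Proof.
move=> S S' By yys rig.
have Sy : S y by rewrite /S /= inE eqxx orbT.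
have S'y : ~~ S' y by rewrite /S' /= negb_or By.
have coefS' f k : only_in S f -> only_in S' (upoly y f)`_k.
  move=> Sf j S'j; apply: free_coef_upoly; have [->|jy] := eqVneq j y; first by right.
  by left; apply: Sf; rewrite /S /= inE negb_or negb_or jy /= -negb_or.
(* Otherwise differentiation along [X_y] alone, [delta y], would contradict rigidity. *)
have [f1 [qf1 Sf1 df1]] : exists f, [/\ q f, only_in S f & phi f^`M(y) != 0].
  apply: contrapT => H; suff /eqP : delta y y = 0 by rewrite /delta eqxx oner_eq0.
  apply: rig => [i|f qf Sf].
    by rewrite inE negb_or /delta => /andP[/negPf ->].
  rewrite dvar_delta; apply/eqP; apply: contrapT => /negP df; apply: H.
  by exists f.
have mderiv_vanishing f : only_in S f -> map_poly phi (upoly y f) = 0 -> phi f^`M(y) = 0.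
  move=> Sf f0; rewrite -dvar_delta (dvar_vanishing _ f0) big1 // => k _.
  by rewrite dvar_delta (free_mderiv_eq0 (coefS' f k Sf y S'y)) rmorph0 mulr0.
(* The least such relation [m] plays the part of the minimal polynomial of [X_y] over the other
   variables, with denominators cleared. *)
pose C s := `[< exists f, [/\ q f, only_in S f, map_poly phi (upoly y f) != 0
  & size (upoly y f) = s] >].
have exC : exists s, C s.
  exists (size (upoly y f1)); apply/asboolP; exists f1; split=> //.
  by apply: contraNneq df1 => f0; rewrite mderiv_vanishing.
case: (ex_minnP exC) => _ /asboolP[m [qm Sm Um <-]] min_m.
have vanish f : q f -> only_in S f -> (size (upoly y f) < size (upoly y m))%N ->
    map_poly phi (upoly y f) = 0.
  move=> qf Sf; rewrite ltnNge => lt; apply/eqP; apply: contraNT lt => Uf.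
  by apply: min_m; apply/asboolP; exists f.
have M0 : upoly y m != 0 by apply: contraNneq Um => ->; rewrite rmorph0.
set l := lead_coef (upoly y m).
have Sl : only_in S' l by apply: coefS'.
have S'S f : only_in S' f -> only_in S f.
  by move=> H j; rewrite /S /= inE orbCA negb_or => /andP[_]; apply: H.
have SX : only_in S ('X_y : A).
  move=> j Sj; have /negPf yj : y != j by apply: contraNneq Sj => <-.
  by rewrite /free killX yj.
have only_inM (f g : A) : only_in S f -> only_in S g -> only_in S (f * g).
  by move=> Sf Sg j Sj; rewrite /free rmorphM /= Sf // Sg.
(* If [l] were in [q], dropping the leading term would keep the image over [L] and lower the
   degree. *)
have nql : ~ q l.
  move=> ql; pose k := (size (upoly y m)).-1; pose m' := m - l * 'X_y ^+ k.
  have Um' : upoly y m' = upoly y m - l%:P * 'X^k.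
    by rewrite rmorphB rmorphM /= rmorphXn /= upolyX eqxx (free_upoly (Sl y S'y)).
  have SXk : only_in S ('X_y ^+ k : A).
    by elim: {m' Um'}k => [|k IH]; [move=> j _; apply: rmorph1|rewrite exprS; apply: only_inM].
  have qm' : q m'.
    by rewrite /m' -mulrN; apply: prime_idealD => //; apply: prime_idealMr.
  have Sm' : only_in S m'.
    move=> j Sj; rewrite /free rmorphB /= (Sm j Sj).
    by rewrite (only_inM _ _ (S'S _ Sl) SXk j Sj).
  have Um0 : map_poly phi (upoly y m') = map_poly phi (upoly y m).
    by rewrite Um' rmorphB rmorphM /= map_polyC /= (phi0 l).2 // mul0r subr0.
  move/eqP: Um; apply; rewrite -Um0; apply: vanish => //.
  rewrite -[X in (_ < X)%N](prednK (n := size (upoly y m))) ?size_poly_gt0 // ltnS.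
  apply/leq_sizeP => j; rewrite Um' coefB coefCM coefXn leq_eqVlt => /predU1P[<-|kj].
    by rewrite eqxx mulr1 -lead_coefE subrr.
  rewrite gtn_eqF // mulr0 subr0 nth_default //.
  by rewrite -(prednK (n := size (upoly y m))) ?size_poly_gt0.
have phil : phi l != 0 by apply/eqP => /phi0.
(* The remainder has smaller degree in [X_y] than [m], so by minimality its image over [L] is
   zero. *)
have divide f : q f -> only_in S f -> exists k u r, [/\ q r, only_in S r,
    map_poly phi (upoly y r) = 0 & l ^+ k * f = u * m + r].
  move=> qf Sf; have [k [u [r [Sr E sr]]]] := pseudo_division Sy Sf Sm M0.
  have qr : q r.
    have -> : r = l ^+ k * f + (- u) * m by rewrite E mulNr addrAC subrr add0r.
    by apply: prime_idealD => //; apply: prime_idealMl.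
  by exists k, u, r; split=> //; apply: vanish.
(* Separability of [m]: were its derivative in [q], division by [m] would put that of [f1] in [q] as
   well. *)
have dm : phi m^`M(y) != 0.
  have [k [u [r [qr Sr r0 E]]]] := divide f1 qf1 Sf1.
  apply: contraNneq df1 => dm0.
  have := congr1 (dvar (delta y)) E.
  rewrite dvarM0 // dvarD dvarM0 // !dvar_delta dm0 mulr0 add0r.
  rewrite (mderiv_vanishing _ Sr r0) => /eqP.
  by rewrite mulf_eq0 rmorphXn expf_eq0 (negPf phil) andbF => /eqP->.
split.
  move=> v vys kill_v.
  (* The value on [X_y] for which the extended derivation kills [m]. *)
  pose w := - dvar v m / phi m^`M(y).
  pose v' i := v i + w * delta y i.
  have dv' f : dvar v' f = dvar v f + w * phi f^`M(y) by rewrite dvar_lin dvar_delta.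
  have v'0 : forall i, v' i = 0.
    apply: rig => [i|f qf Sf].
      rewrite inE negb_or /v' /delta => /andP[/negPf -> /vys ->].
      by rewrite mulr0 addr0.
    have [k [u [r [qr Sr r0 E]]]] := divide f qf Sf.
    have := congr1 (dvar v') E; rewrite dvarM0 // dvarD dvarM0 //.
    have -> : dvar v' m = 0 by rewrite dv' /w divfK // addrN.
    have -> : dvar v' r = 0.
      rewrite (dvar_vanishing _ r0) big1 // => j _; rewrite dv'.
      rewrite (free_mderiv_eq0 (coefS' r j Sr y S'y)) rmorph0 mulr0 addr0.
      by rewrite kill_v ?mulr0 //; [apply: coef_vanishing|apply: coefS'].
    move/eqP; rewrite mulr0 addr0 mulf_eq0 rmorphXn expf_eq0 (negPf phil) andbF.
    by move/eqP.
  move=> i; have [->|iy] := eqVneq i y; first exact: vys.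
  by have := v'0 i; rewrite /v' /delta (negPf iy) mulr0 addr0.
move=> [c [g [h [s [gS det_g ns span_g]]]]].
pose g' (i : 'I_(c + 1)) := match split i with inl i => g i | inr _ => m end.
pose h' (i : 'I_(c + 1)) := match split i with inl i => h i | inr _ => y end.
have g'l i : g' (lshift 1 i) = g i by rewrite /g' (unsplitK (inl i)).
have g'r i : g' (rshift c i) = m by rewrite /g' (unsplitK (inr i)).
have h'l i : h' (lshift 1 i) = h i by rewrite /h' (unsplitK (inl i)).
have h'r i : h' (rshift c i) = y by rewrite /h' (unsplitK (inr i)).
exists (c + 1)%N, g', h', (s * l); split.
- move=> i; rewrite /g'; case: (split i) => j //; have [qg Sg] := gS j.
  by split=> //; apply: S'S.
(* The old equations do not involve [X_y]. *)
- have -> : jacobian g' h' = block_mx (jacobian g h) 0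
      (\row_(j < c) m^`M(h j)) (const_mx m^`M(y)).
    apply/matrixP => i j; rewrite mxE.
    case: (split_ordP i) => i' ->; case: (split_ordP j) => j' ->;
      rewrite ?g'l ?g'r ?h'l ?h'r ?block_mxEul ?block_mxEur ?block_mxEdl ?block_mxEdr ?mxE //.
    by apply: free_mderiv_eq0; apply: (gS i').2.
  rewrite det_lblock det_mx11 mxE; apply: prime_ideal_mul_notin => //.
  by move/phi0/eqP; rewrite (negPf dm).
- exact: prime_ideal_mul_notin.
move=> f qf Sf; have [k [u [r [qr Sr r0 E]]]] := divide f qf Sf.
have sub_g' f' : ideal_span (range g) f' -> ideal_span (range g') f'.
  apply: ideal_span_sub; [exact: ideal_span0|exact: ideal_spanD|exact: ideal_spanMl|].
  by move=> _ [i _ <-]; apply: ideal_span_mem; exists (lshift 1 i).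
(* The coefficients of [r] lie in [q] and avoid [X_y], so the old equations generate them after
   inverting [s]; the largest exponent serves for all. *)
have [e spanr] : exists e, ideal_span (range g') (s ^+ e * r).
  have ex_e j : exists e, ideal_span (range g') (s ^+ e * (upoly y r)`_j).
    have [|e He] := span_g (upoly y r)`_j (coef_vanishing j r0); first exact: coefS'.
    by exists e; apply: sub_g'.
  have /choice [e He] := ex_e.
  have [E0 ej] : exists E0, forall j : 'I_(size (upoly y r)), (e j <= E0)%N.
    exists (\max_(j < size (upoly y r)) e j)%N => j.
    exact: (leq_bigmax (F := fun j : 'I_(size (upoly y r)) => e j) j).
  exists E0; rewrite [X in _ * X](upoly_expand y r) mulr_sumr.
  apply: ideal_span_sum => j; rewrite mulrCA; apply: ideal_spanMl.
  by rewrite -(subnK (ej j)) exprD -mulrA; apply: ideal_spanMl.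
exists (k + e)%N.
have -> : (s * l) ^+ (k + e) * f = s ^+ (k + e) * l ^+ e * (l ^+ k * f).
  by rewrite exprMn [l ^+ (k + e)]exprD; ring.
rewrite E mulrDr; apply: ideal_spanD.
  rewrite mulrA; apply: ideal_spanMl; apply: ideal_span_mem.
  by exists (rshift c ord0).
have -> : s ^+ (k + e) * l ^+ e * r = s ^+ k * l ^+ e * (s ^+ e * r).
  by rewrite exprD; ring.
exact: ideal_spanMl.
Qed.

(** Over [B] alone there is no relation, so the empty family of equations starts the induction. *)
Lemma triangular_of_rigid (B : pred 'I_n) ys :
  uniq ys -> all (predC B) ys -> (forall f, q f -> only_in B f -> f = 0) ->
  rigid [pred i | B i || (i \in ys)] ys -> triangular [pred i | B i || (i \in ys)].
Proof.
move=> + + B0; elim: ys => [_ _ _|y ys IH /= /andP[yys uys] /andP[By Bys] rig].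
  exists 0%N, (fun=> 0), (fun i : 'I_0 => False_rect 'I_n (notF (ltn_ord i))), 1.
  split=> [[]//|||f qf Sf]; [|exact: prime_ideal1|].
    by rewrite det_mx00; apply: prime_ideal1.
  exists 0%N; rewrite expr0 mul1r (B0 f) //; first exact: ideal_span0.
  by move=> j Bj; apply: Sf; rewrite inE orbF.
have [rig' step] := triangular_step By yys rig.
exact/step/IH.
Qed.

(** All exponents are divisible by [p] and all coefficients have [p]-th roots; additivity of the
    Frobenius assembles the root of [f]. *)
Lemma pchar_power_of_mderiv (f : A) : (forall i, f^`M(i) = 0) ->
  (exists c, f = c%:MP) \/
  exists p, p \in [pchar A] /\ exists g : A, f = g ^+ p.
Proof.
move=> df; have coef0f (mm : 'X_{1..n}) i : f@_mm *+ mm i = 0.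
  have [->|mi] := eqVneq (mm i) 0%N; first by rewrite mulr0n.
  have := mcoeff_deriv i (mm - U_(i))%MM f; rewrite df mcoeff0 submK; last first.
    by apply/mnm_lepP => j; rewrite mnm1E; case: eqP => // <-; rewrite lt0n.
  by rewrite mnmBE mnm1E eqxx subn1 prednK ?lt0n.
have [[mm [i [mf mi]]]|H] := pselect (exists mm : 'X_{1..n}, exists i,
    mm \in msupp f /\ mm i != 0%N); last first.
  left; exists f@_0; apply/mpolyP => mm; rewrite mcoeffC.
  case: (eqVneq 0%MM mm) => [<-|mm0]; first by rewrite mulr1.
  rewrite mulr0; apply: memN_msupp_eq0; apply/negP => mf; apply: H; exists mm.
  apply: contrapT => H; move/eqP: mm0; apply; apply/mnmP => i; rewrite mnm0E.
  by apply/esym/eqP; apply: contrapT => /negP mi; apply: H; exists i.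
right; have [||p pK] := @natf0_pchar K (mm i); first by rewrite lt0n.
  have /eqP := coef0f mm i; rewrite -[_ *+ _]mulr_natr mulf_eq0 => /orP[|//].
  by rewrite mcoeff_eq0 mf.
have pA : p \in [pchar A] := rmorph_pchar (@mpolyC n K) pK.
exists p; split=> //; have [r rE] := choice (perfectK pK).
have p0 : (0 < p)%N by rewrite prime_gt0 // (pcharf_prime pK).
exists (\sum_(k <- msupp f) r f@_k *: 'X_[[multinom (k j %/ p)%N | j < n]]).
rewrite -(pFrobenius_autE pA) rmorph_sum /= {1}(mpolyE f).
apply: eq_big_seq => k kf; rewrite pFrobenius_autE exprZn rE mpolyXn.
congr (_ *: 'X_[_]); apply/mnmP => j; rewrite mulmnE mnmE divnK //.
rewrite (dvdn_pcharf pK); have /eqP := coef0f k j.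
rewrite -[_ *+ _]mulr_natr mulf_eq0 => /orP[|//].
by rewrite mcoeff_eq0 kf.
Qed.

Lemma pchar_expr_inj (D : idomainType) p : p \in [pchar D] ->
  injective (fun x : D => x ^+ p).
Proof.
move=> pD x y /= xy; apply/eqP; rewrite -subr_eq0.
have := pFrobenius_autB_comm pD (mulrC x y); rewrite !pFrobenius_autE xy subrr.
by move/eqP; rewrite expf_eq0 => /andP[].
Qed.

Lemma msize_mderiv (f : A) i : f^`M(i) != 0 -> (msize f^`M(i) < msize f)%N.
Proof.
move=> df; rewrite -(mlead_deg df); have := mlead_supp df.
rewrite mcoeff_msupp mcoeff_deriv => nz.
apply: leq_ltn_trans (_ : mdeg (mlead f^`M(i) + U_(i))%MM < _)%N.
  by rewrite mdegD mdeg1 addn1.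
apply: msize_mdeg_lt; rewrite mcoeff_msupp; apply: contraNneq nz => ->.
by rewrite mul0rn.
Qed.

(* A nonzero relation of least degree among the variables in [B] would have all
   derivatives zero, hence be a [p]-th power as [K] is perfect. *)
Lemma independent_of_mderiv (B : pred 'I_n) :
  (forall i f, B i -> q f -> only_in B f -> q f^`M(i)) ->
  forall f, q f -> only_in B f -> f = 0.
Proof.
move=> dB f; have [k] := ubnP (msize f); elim: k f => // k IH f.
rewrite ltnS => fk qf Bf; apply/eqP; apply: contrapT => /negP f0.
have df i : f^`M(i) = 0.
  apply/eqP; apply: contrapT => /negP df0.
  have [Bi|Bi] := boolP (B i); last by rewrite (free_mderiv_eq0 (Bf i Bi)) eqxx in df0.
  move/eqP: (df0); apply; apply: IH; last by move=> j Bj; apply: free_mderiv; apply: Bf.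
    exact: leq_trans (msize_mderiv df0) fk.
  exact: dB.
have no_const c : q c%:MP -> c = 0.
  move=> qc; apply/eqP; apply: contrapT => /negP c0; apply: (prime_ideal1 prime_q).
  by rewrite -mpolyC1 -(mulVf c0) mpolyCM; apply: prime_idealMl.
case: (pchar_power_of_mderiv df) => [[c fE]|[p [pA [g fE]]]].
  by rewrite fE (no_const c) ?mpolyC0 ?eqxx // -fE in f0.
have qg : q g.
  by apply: contrapT => nqg; apply: (prime_ideal_pow_notin prime_q nqg (k := p)); rewrite -fE.
have g0 : g != 0.
  apply: contraNneq f0 => g0; rewrite fE g0 expr0n.
  by case: p pA {fE} => // /andP[].
have Bg : only_in B g.
  move=> j Bj; apply: (pchar_expr_inj pA) => /=.
  by rewrite -rmorphXn -fE; apply: Bf.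
move/eqP: (g0); apply; apply: IH => //.
have p1 : (1 < p)%N by rewrite prime_gt1 // (pcharf_prime pA).
apply: leq_trans fk; rewrite -(mlead_deg f0) -(mlead_deg g0) ltnS fE mleadX // mdegMn.
rewrite ltn_Pmulr // lt0n mdeg_eq0; apply/negP => /eqP lg0.
have gC : g = (g@_0%MM)%:MP by apply: msize1_polyC; rewrite -(mlead_deg g0) lg0 mdeg0.
by move: qg g0; rewrite gC => /no_const ->; rewrite mpolyC0 eqxx.
Qed.

(** A minor of maximal size only serves to split the variables into independent ones, [B], and its
    columns, along which rigidity holds. The generators come from the elimination, not from its
    rows. *)
Lemma generic_smoothness : exists c (g : 'I_c -> A) (h : 'I_c -> 'I_n) s,
  [/\ forall i, q (g i), ~ q (\det (jacobian g h)), ~ q s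
    & forall f, q f -> exists k, ideal_span (range g) (s ^+ k * f)].
Proof.
pose minor c (gh : ('I_c -> A) * ('I_c -> 'I_n)) :=
  (forall i, q (gh.1 i)) /\ ~ q (\det (jacobian gh.1 gh.2)).
(* Repeated columns give determinant 0; hence [c <= n], and a maximal size exists. *)
have minor_inj c gh : minor c gh -> injective gh.2.
  move=> [_ nd] j1 j2 e; apply/eqP; apply: contrapT => /negP j12; apply: nd.
  rewrite -det_tr (determinant_alternate j12); first exact: prime_ideal0.
  by move=> i; rewrite !mxE e.
pose P c := `[< exists gh, minor c gh >].
have exP : exists c, P c.
  exists 0%N; apply/asboolP.
  exists ((fun=> 0), (fun i : 'I_0 => False_rect 'I_n (notF (ltn_ord i)))).
  by split=> [[]//|]; rewrite det_mx00; apply: prime_ideal1.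
have ubP c : P c -> (c <= n)%N.
  move=> /asboolP[gh /minor_inj/leq_card]; by rewrite !card_ord.
case: (ex_maxnP exP ubP) => c /asboolP[[g h] mgh] max_c; have [/= qg nd] := mgh.
have h_inj : injective h := minor_inj _ _ mgh.
pose B : pred 'I_n := [pred i | i \notin codom h].
(* A relation in the variables of [B] has zero derivatives along the columns [h]. If a derivative
   along [B] were outside [q], bordering the matrix would give a larger minor. *)
have B0 f : q f -> only_in B f -> f = 0.
  apply: independent_of_mderiv => {f} i f Bi qf Bf; apply: contrapT => ndf.
  have := max_c (c + 1)%N; rewrite addn1 ltnn -addn1 => /(_ _)/negP; apply=> //.
  apply/asboolP.
  pose g' (i : 'I_(c + 1)) := match split i with inl i => g i | inr _ => f end.
  pose h' (k : 'I_(c + 1)) := match split k with inl k => h k | inr _ => i end.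
  exists (g', h'); split=> /= [k|]; first by rewrite /g'; case: split.
  have g'l k : g' (lshift 1 k) = g k by rewrite /g' (unsplitK (inl k)).
  have g'r k : g' (rshift c k) = f by rewrite /g' (unsplitK (inr k)).
  have h'l k : h' (lshift 1 k) = h k by rewrite /h' (unsplitK (inl k)).
  have h'r k : h' (rshift c k) = i by rewrite /h' (unsplitK (inr k)).
  have -> : jacobian g' h' = block_mx (jacobian g h)
      (\col_(k < c) (g k)^`M(i)) 0 (const_mx f^`M(i)).
    apply/matrixP => k j; rewrite mxE.
    case: (split_ordP k) => k' ->; case: (split_ordP j) => j' ->;
      rewrite ?g'l ?g'r ?h'l ?h'r ?block_mxEul ?block_mxEur ?block_mxEdl ?block_mxEdr ?mxE //.
    by apply: free_mderiv_eq0; apply: Bf; rewrite /B /= negbK codom_f.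
  by rewrite det_ublock det_mx11 mxE; apply: prime_ideal_mul_notin.
have rig : rigid [pred i | B i || (i \in codom h)] (codom h).
  move=> v v0 kill_v i.
  pose M := map_mx phi (jacobian g h).
  have vM : M *m (\col_j v (h j)) = 0.
    apply/matrixP => k z; rewrite !mxE.
    rewrite -[RHS](kill_v (g k) (qg k)); last by move=> j; rewrite /= /B /= orNb.
    rewrite /dvar (bigID (mem (codom h))) /= [X in _ + X]big1 ?addr0; last first.
      by move=> j /v0 ->; rewrite mulr0.
    have uc : uniq (codom h) by rewrite map_inj_uniq ?enum_uniq.
    rewrite -(big_uniq _ uc) codomE big_map big_enum.
    by apply: eq_bigr => j _; rewrite !mxE.
  have detM : \det M != 0 by rewrite det_map_mx; apply/eqP => /phi0.
  have [/codomP[j ->]|/v0//] := boolP (i \in codom h).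
  have uM : M \in unitmx by rewrite unitmxE unitfE.
  have := congr1 (mulmx (invmx M)) vM; rewrite mulmx0 mulKmx //.
  by move/matrixP/(_ j ord0); rewrite !mxE.
have [||c' [g' [h' [s [gS nd' ns span_g]]]]] := triangular_of_rigid _ _ B0 rig.
- by rewrite map_inj_uniq ?enum_uniq.
- by apply/allP => i ih; rewrite /= /B /= ih.
exists c', g', h', s; split=> // [i|f qf]; first by case: (gS i).
by apply: span_g => // j; rewrite /= /B /= orNb.
Qed.

End GenericSmoothness.

(** * Noetherian induction and the decomposition *)

(** [nxt N] is a position where the minimum of the tail from [N] on is attained. *)
Lemma nondecreasing_subsequence (f : nat -> nat) :
  exists2 g : nat -> nat, (forall k, g k < g k.+1)%N &
    forall k, (f (g k) <= f (g k.+1))%N.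
Proof.
have /choice [nxt nxtP] (N : nat) : exists i, (N <= i)%N /\ forall j, (N <= j)%N -> (f i <= f j)%N.
  pose P v := `[< exists i, (N <= i)%N /\ f i = v >].
  have exP : exists v, P v by exists (f N); apply/asboolP; exists N.
  case: (ex_minnP exP) => _ /asboolP[i [Ni <-]] min_i; exists i; split=> // j Nj.
  by apply: min_i; apply/asboolP; exists j.
pose g k := iter k (fun i => nxt i.+1) (nxt 0%N).
exists g => k; first exact: (nxtP _).1.
have [b gk] : exists b, g k = nxt b /\ (b <= g k)%N.
  by case: k => [|k]; [exists 0%N|exists (g k).+1; split=> //; exact: (nxtP _).1].
by rewrite gk.1; apply: (nxtP _).2; apply: leq_trans gk.2 _; apply/ltnW/(nxtP _).1.
Qed.

(** Subsequences are extracted coordinate by coordinate; further extraction preserves the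
    monotonicity already obtained. *)
Lemma dickson n (F : nat -> 'X_{1..n}) :
  exists a b, (a < b)%N /\ (F a <= F b)%MM.
Proof.
suff [g g_inc Fg] : exists2 g : nat -> nat, (forall k, g k < g k.+1)%N &
    forall i, i \in enum 'I_n -> forall k, (F (g k) i <= F (g k.+1) i)%N.
  exists (g 0%N), (g 1%N); split=> //; apply/mnm_lepP => i.
  by apply: Fg; rewrite mem_enum.
elim: (enum 'I_n) => [|i s [g g_inc Fg]]; first by exists id.
have [h h_inc Fh] := nondecreasing_subsequence (fun k => F (g k) i).
have g_mono := homo_ltn ltn_trans g_inc.
exists (g \o h) => [k|j]; first exact: g_mono.
rewrite inE => /predU1P[->|js] k; first exact: Fh.
have Fj := @homo_leq _ (fun k => F (g k) j) leq leqnn leq_trans (Fg j js).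
exact/Fj/ltnW.
Qed.

Section Noetherian.
Variables (K : fieldType) (n : nat).
Local Notation A := {mpoly K[n]}.
Implicit Types (I J : set A) (f g : A).

Definition is_ideal I : Prop :=
  [/\ I 0, forall u v, I u -> I v -> I (u + v) & forall a u, I u -> I (a * u)].

Lemma mlead_reduce f g : f != 0 -> g != 0 -> (mlead g <= mlead f)%MM ->
  exists c, f - c * g = 0 \/ (mlead (f - c * g) < mlead f)%O.
Proof.
move=> f0 g0 le_gf; pose a := mleadc f / mleadc g.
have lf0 : mleadc f != 0 by rewrite mleadc_eq0.
have lg0 : mleadc g != 0 by rewrite mleadc_eq0.
have a0 : a != 0 by rewrite mulf_neq0 // invr_eq0.
pose c := a *: 'X_[mlead f - mlead g]; exists c.
have X0 : 'X_[mlead f - mlead g] != 0 :> A by rewrite -msize_poly_eq0 msizeX.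
have lc : (mlead c + mlead g)%MM = mlead f by rewrite mleadZ // mleadXm submK.
have cg : mlead (c * g) = mlead f.
  by rewrite mleadM // scaler_eq0 negb_or a0.
have [->|h0] := eqVneq (f - c * g) 0; [by left|right].
rewrite Order.POrderTheory.lt_neqAle; apply/andP; split; last first.
  by have := mleadB_le f (c * g); rewrite cg Order.JoinTheory.joinxx.
apply: contraNneq h0 => lh; rewrite -mleadc_eq0 lh mcoeffB -{2}lc mleadcM.
by rewrite mleadcZE mleadXm mcoeffX eqxx mulr1 divfK // subrr.
Qed.

(** Elements outside the current span, with least leading monomial, are added one by one. By
    Dickson's lemma an earlier leading monomial divides a later one, and one reduction step
    contradicts minimality. *)
Theorem hilbert_basis I : is_ideal I ->
  exists s : seq A, (forall f, f \in s -> I f) /\ I `<=` ideal_span [set` s].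
Proof.
move=> [I0 ID IM]; apply: contrapT => nfg.
have step (s : seq A) : exists f, (forall g, g \in s -> I g) ->
    [/\ I f, ~ ideal_span [set` s] f & forall g, I g -> ~ ideal_span [set` s] g ->
      ~ (mlead g < mlead f)%O].
  have [sI|] := pselect (forall g, g \in s -> I g); last by exists 0.
  have [f0 [If0 nf0]] : exists f, I f /\ ~ ideal_span [set` s] f.
    apply: contrapT => H; apply: nfg; exists s; split=> // f If.
    by apply: contrapT => nf; apply: H; exists f.
  elim/mleadrect: f0 If0 nf0 => f IH If nf.
  have [[g [Ig ng lg]]|H] := pselect (exists g, [/\ I g, ~ ideal_span [set` s] g
    & (mlead g < mlead f)%O]); first exact: IH lg Ig ng.
  by exists f => _; split=> // g Ig ng lg; apply: H; exists g.
have [nxt nxtP] := choice step.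
pose L k := iter k (fun s => nxt s :: s) [::].
have LI k : forall g, g \in L k -> I g.
  elim: k => // k IH g; rewrite /L iterS inE => /predU1P[->|]; last exact: IH.
  by have [] := nxtP _ IH.
pose f k := nxt (L k).
have fL a b : (a < b)%N -> f a \in L b.
  elim: b => // b IH; have Lb : L b.+1 = f b :: L b by [].
  rewrite Lb in_cons ltnS leq_eqVlt => /orP[/eqP->|/IH->]; first by rewrite eqxx.
  by rewrite orbT.
have [a [b [ab le_ab]]] := dickson (fun k => mlead (f k)).
have [Ifa nfa _] := nxtP _ (LI a); have [Ifb nfb min_b] := nxtP _ (LI b).
rewrite -!/(f _) in Ifa nfa Ifb nfb min_b.
have fa0 : f a != 0 by apply: contra_notN nfa => /eqP ->; apply: ideal_span0.
have fb0 : f b != 0 by apply: contra_notN nfb => /eqP ->; apply: ideal_span0.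
have [c H] := mlead_reduce fb0 fa0 le_ab.
have span_fa : ideal_span [set` L b] (c * f a).
  by apply: ideal_spanMl; apply: ideal_span_mem; apply: fL.
have nspan : ~ ideal_span [set` L b] (f b - c * f a).
  by move=> H'; apply: nfb; rewrite -[f b](subrK (c * f a)); apply: ideal_spanD.
case: H => [h0|]; first by apply: nspan; rewrite h0; apply: ideal_span0.
by apply: min_b => //; rewrite -mulNr; apply: ID => //; apply: IM.
Qed.

(** A counterexample yields, by choice, a strictly increasing chain of ideals, but the finite
    generators of its union already lie in one member. *)
Lemma noetherian_ind (P : set A -> Prop) :
  (forall I, is_ideal I ->
     (forall J, is_ideal J -> I `<=` J -> ~ J `<=` I -> P J) -> P I) ->
  forall I, is_ideal I -> P I.
Proof.
move=> IH I idI; apply: contrapT => nPI.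
have step (J : set A) : exists J', is_ideal J /\ ~ P J ->
    [/\ is_ideal J', ~ P J', J `<=` J' & ~ J' `<=` J].
  have [[idJ nPJ]|] := pselect (is_ideal J /\ ~ P J); last by exists J.
  apply: contrapT => H; apply: nPJ; apply: IH => // J' idJ' s1 s2.
  by apply: contrapT => nPJ'; apply: H; exists J'.
have [nxt nxtP] := choice step.
pose C k := iter k nxt I.
have Cbad k : is_ideal (C k) /\ ~ P (C k).
  by elim: k => // k /nxtP[].
have Csub k : C k `<=` C k.+1 by have [] := nxtP _ (Cbad k).
have Cmono j k : (j <= k)%N -> C j `<=` C k.
  move=> /subnK <-; elim: (k - j)%N => // d sub f Cf; exact/Csub/sub.
pose U : set A := [set f | exists k, C k f].
have idU : is_ideal U.
  split=> [|u v [j Cu] [k Cv]|a u [k Cu]].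
  - by exists 0%N; case: idI.
  - exists (maxn j k); have [[_ CD _] _] := Cbad (maxn j k); apply: CD.
      exact: Cmono (leq_maxl _ _) _ Cu.
    exact: Cmono (leq_maxr _ _) _ Cv.
  by exists k; have [[_ _ CM] _] := Cbad k; apply: CM.
have [s [sU Us]] := hilbert_basis idU.
have [k sC] : exists k, forall f, f \in s -> C k f.
  elim: s sU {Us} => [|f s IHs] sU; first by exists 0%N.
  have [k sC] := IHs (fun g gs => sU g (mem_behead (s := f :: s) gs)).
  have [j Cf] := sU f (mem_head _ _); exists (maxn j k) => g.
  rewrite inE => /predU1P[->|/sC Cg]; first exact: Cmono (leq_maxl _ _) _ Cf.
  exact: Cmono (leq_maxr _ _) _ Cg.
have [_ _ _ +] := nxtP _ (Cbad k); apply=> f Cf.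
have [[C0 CD CM] _] := Cbad k.
by apply: (ideal_span_sub C0 CD CM sC); apply: Us; exists k.+1.
Qed.

End Noetherian.

(** * Definability of the pieces *)

Section Definable.
Variables (K : fieldType) (n : nat).
Implicit Types (X Y : set (n.-tuple K)) (p : {mpoly K[n]}).

Lemma mpoly_term p : exists t : GRing.term K, GRing.rterm t /\
  forall a : n.-tuple K, GRing.eval a t = p.@[tnth a].
Proof.
pose T q := exists t : GRing.term K, GRing.rterm t /\
  forall a : n.-tuple K, GRing.eval a t = q.@[tnth a].
have TM q r : T q -> T r -> T (q * r).
  move=> [t [rt E]] [u [ru F]]; exists (GRing.Mul t u); rewrite /= rt ru; split=> // a.
  by rewrite E F mevalM.
have TC c : T c%:MP by exists (GRing.Const c); split=> // a; rewrite mevalC.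
rewrite -/(T p); elim/mpolyind: p => [|c k p _ _ [t [rt E]]].
  by rewrite -mpolyC0; apply: (TC).
have [u [ru F]] : T (c *: 'X_[k]).
  rewrite -mul_mpolyC; apply: (TM) => //; rewrite mpolyXE_id.
  elim/big_ind: _ => [|q r Tq Tr|i _]; [by rewrite -mpolyC1; apply: (TC)|exact: TM|].
  exists (GRing.Exp (GRing.Var K i) (k i)); split=> // a.
  by rewrite rmorphXn /= mevalXU (tnth_nth 0).
by exists (GRing.Add u t); rewrite /= ru rt; split=> // a; rewrite E F mevalD.
Qed.

Lemma definable_zeros p : definable [set a : n.-tuple K | p.@[tnth a] = 0].
Proof.
have [t [rt E]] := mpoly_term p.
exists (GRing.Equal t (GRing.Const 0)); rewrite /= rt; split=> //.
by apply/seteqP; split=> a /=; rewrite E.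
Qed.

Lemma definableI X Y : definable X -> definable Y -> definable (X `&` Y).
Proof. by move=> [f [rf ->]] [g [rg ->]]; exists (GRing.And f g); rewrite /= rf rg. Qed.

Lemma definableC X : definable X -> definable (~` X).
Proof. by move=> [f [rf ->]]; exists (GRing.Not f). Qed.

Lemma definable_all_zeros (s : seq {mpoly K[n]}) :
  definable [set a : n.-tuple K | forall f, f \in s -> f.@[tnth a] = 0].
Proof.
elim: s => [|f s IH].
  by exists (GRing.Bool true); split=> //; apply/seteqP; split=> a.
have := definableI (definable_zeros f) IH; congr definable.
apply/seteqP; split=> a /= => [[fa sa] g|H].
  by rewrite inE => /predU1P[->|/sa].
by split=> [|g gs]; apply: H; rewrite inE ?eqxx ?gs ?orbT.
Qed.

Lemma definable_rational_points (V : subvariety K n) : definable (rational_points V).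
Proof.
have := definableI (definable_all_zeros (eqns V))
                   (definableC (definable_all_zeros (ineqns V))).
congr definable; apply/seteqP; split=> a [ea ia]; split=> //.
  apply: contrapT => H; apply: ia => g gV; apply/eqP; apply: contrapT => /negP ga.
  by apply: H; exists g.
by move=> H; have [g gV] := ia; rewrite H ?eqxx.
Qed.

Lemma existentially_definable_definable X : existentially_definable X -> definable X.
Proof.
move=> [s [f [_ rf ->]]]; exists (foldr GRing.Exists f s); split=> //.
by elim: s.
Qed.

End Definable.

(** * Splitting locally closed sets into smooth pieces *)

Section Decomposition.
Variables (R : idomainType) (K : fieldType) (iota : {rmorphism R -> K}) (n : nat).
Local Notation A := {mpoly K[n]}.

(** The bound [D] on the points of the pieces preserves disjointness when two decompositions are
    united. *)
Definition decomposable (D : set (set A)) (Y : set (n.-tuple K)) : Prop :=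
  exists (k : nat) (V : 'I_k -> subvariety K n) (O : 'I_k -> set (n.-tuple K)),
    [/\ forall i, points (V i) `<=` D,
        forall i j : 'I_k, i != j -> points (V i) `&` points (V j) = set0,
        forall i : 'I_k, irreducible_subvariety (V i) /\ smooth (V i),
        forall i : 'I_k,
          definable (O i) /\ radic_open_in iota (rational_points (V i)) (O i)
      & Y = \bigcup_(i in [set: 'I_k]) O i].

Lemma decomposable0 D : decomposable D set0.
Proof.
exists 0%N, (fun=> Subvariety [::] [::]), (fun=> set0); split=> [[]|[]|[]|[]|] //.
by apply/seteqP; split=> // a [[]].
Qed.

Lemma decomposable1 D V O : points V `<=` D -> irreducible_subvariety V -> smooth V ->
  definable O -> radic_open_in iota (rational_points V) O -> decomposable D O.
Proof.
move=> VD irrV smV defO opO; exists 1%N, (fun=> V), (fun=> O); split=> //.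
  by move=> i j; rewrite (ord1 i) (ord1 j).
by apply/seteqP; split=> [a Oa|a [i _]]//; exists ord0.
Qed.

Lemma decomposable_sub D D' Y : D `<=` D' -> decomposable D Y -> decomposable D' Y.
Proof.
move=> DD' [k [V [O [VD dis sm op YE]]]]; exists k, V, O; split=> // i.
exact: subset_trans (VD i) DD'.
Qed.

Lemma decomposableU D1 D2 Y1 Y2 : D1 `&` D2 = set0 ->
  decomposable D1 Y1 -> decomposable D2 Y2 -> decomposable (D1 `|` D2) (Y1 `|` Y2).
Proof.
move=> D12 [k1 [V1 [O1 [VD1 dis1 sm1 op1 ->]]]] [k2 [V2 [O2 [VD2 dis2 sm2 op2 ->]]]].
pose V (i : 'I_(k1 + k2)) := match split i with inl i => V1 i | inr i => V2 i end.
pose O (i : 'I_(k1 + k2)) := match split i with inl i => O1 i | inr i => O2 i end.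
have Vl i : V (lshift k2 i) = V1 i by rewrite /V (unsplitK (inl i)).
have Vr i : V (rshift k1 i) = V2 i by rewrite /V (unsplitK (inr i)).
have Ol i : O (lshift k2 i) = O1 i by rewrite /O (unsplitK (inl i)).
have Or i : O (rshift k1 i) = O2 i by rewrite /O (unsplitK (inr i)).
have dis12 i j : points (V1 i) `&` points (V2 j) = set0.
  apply/seteqP; split=> // p [p1 p2]; rewrite -D12.
  by split; [apply: VD1 p1|apply: VD2 p2].
exists (k1 + k2)%N, V, O; split.
- move=> i; case: (split_ordP i) => j ->; rewrite ?Vl ?Vr => p pV.
    by left; apply: VD1 pV.
  by right; apply: VD2 pV.
- move=> i j; case: (split_ordP i) => i' ->; case: (split_ordP j) => j' ->;
    rewrite ?Vl ?Vr ?eq_lshift ?eq_rshift => ij.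
  + exact: dis1.
  + exact: dis12.
  + by rewrite setIC dis12.
  + exact: dis2.
- by move=> i; case: (split_ordP i) => j ->; rewrite ?Vl ?Vr.
- by move=> i; case: (split_ordP i) => j ->; rewrite ?Vl ?Vr ?Ol ?Or.
apply/seteqP; split=> [a [[i _ Oa]|[i _ Oa]]|a [i _]].
- by exists (lshift k2 i); rewrite ?Ol.
- by exists (rshift k1 i); rewrite ?Or.
case: (split_ordP i) => j ->; rewrite ?Ol ?Or => Oa; first by left; exists j.
by right; exists j.
Qed.

(** The difference of the zero sets of [I] and [J]. As [J] is any set of polynomials, multiplying
    its elements by [f] removes the zeros of [f] too. *)
Definition locus (I J : set A) : set (set A) :=
  [set p | [/\ prime_ideal p, I `<=` p & ~ J `<=` p]].

Definition rational_locus (I J : set A) : set (n.-tuple K) :=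
  [set a | (forall f, I f -> f.@[tnth a] = 0) /\
           exists2 g, J g & g.@[tnth a] != 0].

Definition adjoin (I : set A) (f : A) : set A :=
  [set g | exists h c, I h /\ g = h + c * f].

Lemma adjoin_is_ideal I f : is_ideal I -> is_ideal (adjoin I f).
Proof.
move=> [I0 ID IM]; split=> [|u v [h [c [Ih ->]]] [h' [c' [Ih' ->]]]|a u [h [c [Ih ->]]]].
- by exists 0, 0; split=> //; rewrite mul0r addr0.
- by exists (h + h'), (c + c'); split; [exact: ID|ring].
- by exists (a * h), (a * c); split; [exact: IM|ring].
Qed.

Lemma sub_adjoin I f : I `<=` adjoin I f.
Proof. by move=> g Ig; exists g, 0; split=> //; rewrite mul0r addr0. Qed.

Lemma mem_adjoin I f : is_ideal I -> adjoin I f f.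
Proof. by move=> [I0 _ _]; exists 0, 1; split=> //; rewrite mul1r add0r. Qed.

(** The cut is along [f = 0]; off this hypersurface [g] vanishes because [f * g] does. *)
Lemma locus_adjoin_split I J f g : is_ideal I -> I (f * g) ->
  [/\ locus (adjoin I f) J `&` locus (adjoin I g) [set j * f | j in J] = set0,
      locus (adjoin I f) J `|` locus (adjoin I g) [set j * f | j in J] `<=` locus I J
    & rational_locus I J = rational_locus (adjoin I f) J `|`
                           rational_locus (adjoin I g) [set j * f | j in J]].
Proof.
move=> idI Ifg; split.
- apply/seteqP; split=> // p [[pp Ip _] [_ _ nJ]]; apply: nJ => _ [j _ <-].
  by apply: prime_idealMl => //; apply/Ip/mem_adjoin.
- move=> p [] [pp Ip nJ]; split=> //; try exact: subset_trans (@sub_adjoin _ _) Ip.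
  by move=> Jp; apply: nJ => _ [j Jj <-]; apply: prime_idealMr => //; apply: Jp.
have adj h (a : n.-tuple K) : (forall f', I f' -> f'.@[tnth a] = 0) -> h.@[tnth a] = 0 ->
    forall f', adjoin I h f' -> f'.@[tnth a] = 0.
  by move=> Ia ha _ [f' [c [If' ->]]]; rewrite mevalD mevalM ha mulr0 addr0 Ia.
apply/seteqP; split=> a.
  move=> [Ia [j Jj ja]]; have [fa|fa] := eqVneq f.@[tnth a] 0.
    by left; split; [apply: adj|exists j].
  right; split; last by exists (j * f); [exists j|rewrite mevalM mulf_neq0].
  apply: adj => //; apply/eqP; have /eqP := Ia _ Ifg.
  by rewrite mevalM mulf_eq0 (negPf fa).
move=> [] [Ia [j Jj ja]]; split; try by move=> f' If'; apply: Ia; apply: sub_adjoin.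
  by exists j.
case: Jj ja => j' Jj' <-; rewrite mevalM mulf_eq0 negb_or => /andP[j'a _].
by exists j'.
Qed.

Variables (m : set R) (X : set (n.-tuple K)).
Hypotheses (localR : local_ring m) (henselR : henselian m).
Hypotheses (fracK : is_fraction_field iota) (perfectK : perfect_field K).
Hypothesis defX : existentially_definable X.

Lemma is_ideal_prime (q : set A) : prime_ideal q -> is_ideal q.
Proof.
move=> pq; split; [exact: prime_ideal0|exact: prime_idealD|exact: prime_idealMl].
Qed.

(** [q] is the generic point: a closed set containing it contains every prime above it. *)
Lemma irreducible_basic_open (q : set A) (s : seq A) (u : A) : prime_ideal q ->
  (forall f, f \in s -> q f) -> q `<=` ideal_span [set` s] -> ~ q u ->
  irreducible_subvariety (Subvariety s [:: u]).
Proof.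
move=> pq sq qs nqu; have qV : points (Subvariety s [:: u]) q.
  by split=> // -[_ /(_ u)] H; apply: nqu; apply: H; rewrite /= inE.
split=> [|B C H]; first by exists q.
have sub p : points (Subvariety s [:: u]) p -> q `<=` p.
  move=> [[pp sp] _] f /qs; have [p0 pD pM] := is_ideal_prime pp.
  exact: (ideal_span_sub p0 pD pM sp).
case: (H q qV) => -[_ Zq]; [left|right] => p pV; (split; first by case: pV => -[]);
  exact: subset_trans Zq (sub p pV).
Qed.

(** The part of [Z(q)] where [u] is nonzero is a single smooth piece; the remainder is cut out by a
    strictly larger ideal. *)
Lemma prime_decomposition (q J : set A) : prime_ideal q ->
  (forall I, is_ideal I -> q `<=` I -> ~ I `<=` q ->
     decomposable (locus I J) (X `&` rational_locus I J)) ->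
  decomposable (locus q J) (X `&` rational_locus q J).
Proof.
move=> pq IH; have [Jq|nJq] := pselect (J `<=` q).
  suff -> : X `&` rational_locus q J = set0 by exact: decomposable0.
  by apply/seteqP; split=> // a [_ [qa [g /Jq /qa ->]]]; rewrite eqxx.
have [j Jj nqj] : exists2 j, J j & ~ q j.
  apply: contrapT => H; apply: nJq => j Jj; apply: contrapT => nqj; apply: H.
  by exists j.
have [s1 ns1 op] := existential_generically_open localR henselR perfectK defX pq.
have [L [phi [phi0 _]]] := residue_field pq.
have [c [g [h [s2 [qg nd ns2 span_g]]]]] := generic_smoothness perfectK pq phi0.
have [s [sq qs]] := hilbert_basis (is_ideal_prime pq).
set d := \det (jacobian g h) in nd.
(* [s1] gives openness, [s2] local generation and [d] the nonzero minor; [j] keeps the piece away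
   from the zeros of [J]. *)
pose u := s1 * (s2 * (d * j)).
have nu : ~ q u by do 3!apply: prime_ideal_mul_notin => //.
pose V := Subvariety s [:: u].
have sub_span (p : set A) : prime_ideal p -> [set` s] `<=` p -> q `<=` p.
  move=> pp sp f /qs; have [p0 pD pM] := is_ideal_prime pp.
  exact: (ideal_span_sub p0 pD pM sp).
have VP p : points V p -> [/\ prime_ideal p, q `<=` p & ~ p u].
  move=> [[pp sp] np]; split=> //; first exact: sub_span.
  by move=> pu; apply: np; split=> // f; rewrite /= inE => /eqP ->.
have ratV (a : n.-tuple K) : rational_points V a <-> basic_locus q u (tnth a).
  split=> [[sa [u']]|[qa ua]].
    rewrite inE => /eqP -> ua; split=> // f /qs [l [c' [b [sb ->]]]].
    rewrite raddf_sum big1 //= => k _; have bk : b k \in s := sb k.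
    by rewrite mevalM (sa _ bk) mulr0.
  by split=> [f /sq /qa|]; last by exists u; rewrite ?inE.
have smV : smooth V.
  move=> p /VP[pp qp npu]; exists c, g, h; split.
  - by move=> i; apply: qs.
  - move=> f fs; have qf : q f.
      have [q0 qD qM] := is_ideal_prime pq.
      exact: (ideal_span_sub q0 qD qM sq fs).
    have [k Hk] := span_g f qf; exists (s2 ^+ k) => //.
    apply: (prime_ideal_pow_notin pp) => ps2; apply: npu.
    by apply: prime_idealMl => //; apply: prime_idealMr.
  - move=> pd; apply: npu; do 2!apply: (prime_idealMl pp).
    exact: prime_idealMr.
have tupleE (a : n.-tuple K) : [tuple tnth a i | i < n] = a.
  by apply: eq_from_tnth => i; rewrite tnth_mktuple.
have opV : radic_open_in iota (rational_points V) (X `&` rational_points V).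
  pose box (alpha beta : 'I_n -> K) : set (n.-tuple K) :=
    [set b | forall i, radic_basic iota (alpha i) (beta i) (tnth b i)].
  (* The union of all boxes whose trace on the rational points of [V] lies in [X]. *)
  exists [set b | exists alpha beta, [/\ forall i, alpha i != 0, box alpha beta b
      & box alpha beta `&` rational_points V `<=` X]].
    move=> a [alpha [beta [a0 ab H]]]; exists alpha, beta; split=> // b bb.
    by exists alpha, beta.
  apply/seteqP; split=> a [].
    move=> Xa Va; split=> //.
    have [||lam lam0 H] := op iota fracK (tnth a).
    - by rewrite /= tupleE.
    - by have /ratV := Va; rewrite /u => /basic_locusM[].
    exists (fun=> lam), (tnth a); split=> // [i|b [bb Vb]].
      by exists 0; rewrite rmorph0 mulr0 add0r.
    rewrite -[b]tupleE; apply: H; last by have /ratV := Vb; rewrite /u => /basic_locusM[].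
    by move=> i; have [r ->] := bb i; exists r; rewrite addrK.
  by move=> Va [alpha [beta [_ ba H]]]; split=> //; apply: H.
have defV : definable (X `&` rational_points V).
  apply: definableI; [exact: existentially_definable_definable|].
  exact: definable_rational_points.
have D1 : decomposable (points V) (X `&` rational_points V).
  by apply: (@decomposable1 _ V) => //; apply: irreducible_basic_open sq qs nu.
have idq := is_ideal_prime pq.
have D2 : decomposable (locus (adjoin q u) J) (X `&` rational_locus (adjoin q u) J).
  apply: IH; [exact: adjoin_is_ideal|exact: sub_adjoin|].
  by move=> H; apply: nu; apply/H/mem_adjoin.
have -> : X `&` rational_locus q J =
    (X `&` rational_points V) `|` (X `&` rational_locus (adjoin q u) J).
  rewrite -setIUr; congr (_ `&` _); apply/seteqP; split=> a.
    move=> [qa [f Jf fa]]; have [ua|ua] := eqVneq u.@[tnth a] 0; last first.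
      by left; apply/ratV.
    right; split; last by exists f.
    by move=> _ [f' [e [qf' ->]]]; rewrite mevalD mevalM ua mulr0 addr0 qa.
  move=> [/ratV[qa ua]|[qa Ja]].
    split=> //; exists j => //; apply: contraNneq ua => ja.
    by rewrite /u !mevalM ja !mulr0.
  by split=> // f qf; apply: qa; apply: sub_adjoin.
apply: decomposable_sub (decomposableU _ D1 D2).
  move=> p [/VP[pp qp npu]|[pp Ip nJp]].
    split=> // Jp; apply: npu; do 3!apply: (prime_idealMl pp); exact: Jp.
  by split=> //; apply: subset_trans Ip; apply: sub_adjoin.
apply/seteqP; split=> // p [/VP[pp _ npu] [_ Ip _]]; apply: npu.
exact/Ip/mem_adjoin.
Qed.

(** [J] is quantified inside the induction because splitting a nonprime ideal changes it. *)
Lemma locus_decomposition (I : set A) : is_ideal I ->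
  forall J, decomposable (locus I J) (X `&` rational_locus I J).
Proof.
move: I; apply: noetherian_ind => I idI IH J.
have [pI|npI] := pselect (prime_ideal I).
  by apply: prime_decomposition => // I' idI' s1 s2; apply: IH.
have [I1|nI1] := pselect (I 1).
  suff -> : X `&` rational_locus I J = set0 by exact: decomposable0.
  by apply/seteqP; split=> // a [_ [/(_ _ I1)]]; rewrite meval1 => /eqP; rewrite oner_eq0.
have [f [g [Ifg nf ng]]] : exists f g, [/\ I (f * g), ~ I f & ~ I g].
  apply: contrapT => H; apply: npI; have [I0 ID IM] := idI.
  apply: mk_prime_ideal => // f g Ifg; apply: contrapT => nfg; apply: H.
  by exists f, g; split=> // ?; apply: nfg; [left|right].
have [dis sub ->] := locus_adjoin_split J idI Ifg.
have adj h J' : ~ I h ->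
    decomposable (locus (adjoin I h) J') (X `&` rational_locus (adjoin I h) J').
  move=> nh; apply: IH; [exact: adjoin_is_ideal|exact: sub_adjoin|].
  by move=> H; apply: nh; apply/H/mem_adjoin.
by rewrite setIUr; apply: decomposable_sub sub _; apply: decomposableU => //; apply: adj.
Qed.

End Decomposition.

Theorem corollary1p4 (R : idomainType) (m : set R) (K : fieldType)
    (iota : {rmorphism R -> K}) (n : nat) (X : set (n.-tuple K))
    (localR : local_ring m) (henselR : henselian m)
    (fracK : is_fraction_field iota) (perfectK : perfect_field K)
    (defX : existentially_definable X) :
  exists (k : nat) (V : 'I_k -> subvariety K n) (O : 'I_k -> set (n.-tuple K)),
    [/\ forall i j : 'I_k, i != j -> points (V i) `&` points (V j) = set0,
        forall i : 'I_k, irreducible_subvariety (V i) /\ smooth (V i),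
        forall i : 'I_k,
          definable (O i) /\ radic_open_in iota (rational_points (V i)) (O i)
      & X = \bigcup_(i in [set: 'I_k]) O i].
Proof.
have id0 : is_ideal [set 0 : {mpoly K[n]}].
  by split=> [|u v -> ->|a u ->] //=; rewrite ?addr0 ?mulr0.
(* The zero ideal and [J = {1}] describe the whole affine space. *)
have [k [V [O [_ dis sm op XE]]]] :=
  locus_decomposition localR henselR fracK perfectK defX id0 [set 1].
exists k, V, O; split=> //; rewrite -XE; apply/seteqP; split=> a; last by case.
by move=> Xa; split=> //; split=> [f ->|]; [rewrite meval0|exists 1; rewrite ?meval1 ?oner_neq0].
Qed.
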